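(* Let $\Lambda$ be a cyclic Nakayama algebra of infinite global dimension. If $\Lambda$ is a dominant Auslander--Gorenstein algebra, then the dominant dimension of $\Lambda$ is even.
   Context: A cyclic Nakayama algebra is an algebra $\mathbb{K}Q/I$ over a field $\mathbb{K}$ where $Q$ is an oriented cycle and $I$ is an admissible ideal. Modules are finitely generated right modules. Dominant dimension: for a module $M$ with minimal injective resolution $0\to M\to I_0\to I_1\to\cdots$, $\operatorname{dom.dim}M$ is the maximal $t$ (or $\infty$) such that $I_j$ is projective for all $j<t$; $\operatorname{dom.dim}A=\inf\{\operatorname{dom.dim}P\mid P\text{ projective non-injective } A\text{-module}\}$. For this statement, a selfinjective algebra is taken to have dominant dimension zero. A finite-dimensional algebra $A$ is dominant Auslander--Gorenstein if it is Gorenstein (all injective modules have finite projective dimension) and for each indecomposable projective $A$-module $P$ the injective dimension of $P$ is at most $\operatorname{dom.dim}P$. *)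

(* Defs.v *)
From HB Require Import structures.
From mathcomp Require Import all_boot all_order all_algebra all_field.
From mathcomp Require Import finmap.
From mathcomp Require Import boolp.
From mathcomp Require Import monalg.

Set Implicit Arguments.
Unset Strict Implicit.
Unset Printing Implicit Defensive.

Import GRing.Theory.
Local Open Scope ring_scope.

Definition enat := option nat.
Notation fin_enat := (@Some nat).
Notation infty := (@None nat).

Definition ele (x y : enat) : bool :=
  match x, y with
  | _, None => true
  | None, Some _ => false
  | Some m, Some n => (m <= n)%N
  end.

Definition einf (S : enat -> Prop) : enat :=
  match pselect (exists n, `[< S (fin_enat n) >]) with
  | left h => fin_enat (ex_minn h)
  | right _ => infty
  end.

Definition esup (S : enat -> Prop) : enat :=
  einf (fun u => forall s, S s -> ele s u).

Lemma einf_lb S s : S s -> ele (einf S) s.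
Proof.
case: s => [n|] Ss; last by case: einf.
rewrite /einf; case: pselect => [h|[]]; last by exists n; apply/asboolP.
by case: ex_minnP => m _; apply; apply/asboolP.
Qed.

Lemma einf_glb S l : (forall s, S s -> ele l s) -> ele l (einf S).
Proof.
move=> lS; rewrite /einf; case: pselect => [h|_]; last by case: l {lS}.
by case: ex_minnP => m /asboolP Sm _; apply: lS.
Qed.

Lemma esup_ub S s : S s -> ele s (esup S).
Proof. by move=> Ss; apply: einf_glb => u; apply. Qed.

Lemma esup_lub S u : (forall s, S s -> ele s u) -> ele (esup S) u.
Proof. by move=> Su; apply: einf_lb. Qed.

Section Modules.
Variable R : nzRingType.
Implicit Types M N X Y P I : lmodType R.

Definition fin_gen M : Prop :=
  exists s : seq M, forall x : M,
    exists c : 'I_(size s) -> R, x = \sum_i c i *: s`_i.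

Definition zero_mod M : Prop := forall x : M, x = 0.

Definition surj (S T : Type) (f : S -> T) : Prop := forall y, exists x, f x = y.

(* The ambient category is that of finitely generated modules, so lifting and
   extension are tested against finitely generated modules only. *)
Definition proj_mod P : Prop :=
  fin_gen P /\
  forall X Y (g : {linear X -> Y}) (f : {linear P -> Y}),
    fin_gen X -> fin_gen Y -> surj g ->
    exists h : {linear P -> X}, forall x, g (h x) = f x.

Definition inj_mod I : Prop :=
  fin_gen I /\
  forall X Y (g : {linear X -> Y}) (f : {linear X -> I}),
    fin_gen X -> fin_gen Y -> injective g ->
    exists h : {linear Y -> I}, forall x, h (g x) = f x.

Definition indecomposable M : Prop :=
  ~ zero_mod M /\
  forall X Y (f : {linear M -> (X * Y)%type}),
    bijective f -> zero_mod X \/ zero_mod Y.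

Definition exact_at (X Y Z : lmodType R)
    (f : {linear X -> Y}) (g : {linear Y -> Z}) : Prop :=
  forall y, g y = 0 <-> exists x, f x = y.

(* The image of f meets every nonzero submodule of Y nontrivially. *)
Definition essential_image (X Y : lmodType R) (f : {linear X -> Y}) : Prop :=
  forall S : {pred Y}, submod_closed S ->
    (exists2 y, y \in S & y != 0) -> exists2 x, f x \in S & f x != 0.

(* 0 -> M -> I_0 -> I_1 -> ... *)
Record inj_resolution M := InjResolution {
  ir_mod :> nat -> lmodType R;
  ir_aug : {linear M -> ir_mod 0};
  ir_diff : forall j, {linear ir_mod j -> ir_mod j.+1};
  ir_inj : forall j, inj_mod (ir_mod j);
  ir_aug_inj : injective ir_aug;
  ir_exact0 : exact_at ir_aug (ir_diff 0);
  ir_exactS : forall j, exact_at (ir_diff j) (ir_diff j.+1)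
}.

(* Each I_j is an injective envelope of the image of the map into it. *)
Definition minimal_ir M (I : inj_resolution M) : Prop :=
  essential_image (ir_aug I) /\ forall j, essential_image (ir_diff I j).

(* ... -> P_1 -> P_0 -> M -> 0 *)
Record proj_resolution M := ProjResolution {
  pr_mod :> nat -> lmodType R;
  pr_aug : {linear pr_mod 0 -> M};
  pr_diff : forall j, {linear pr_mod j.+1 -> pr_mod j};
  pr_proj : forall j, proj_mod (pr_mod j);
  pr_aug_surj : surj pr_aug;
  pr_exact0 : exact_at (pr_diff 0) pr_aug;
  pr_exactS : forall j, exact_at (pr_diff j.+1) (pr_diff j)
}.

Definition inj_dim M : enat :=
  einf (fun u => exists2 n, u = fin_enat n &
    exists I : inj_resolution M, forall j, (n < j)%N -> zero_mod (I j)).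

Definition proj_dim M : enat :=
  einf (fun u => exists2 n, u = fin_enat n &
    exists P : proj_resolution M, forall j, (n < j)%N -> zero_mod (P j)).

Definition dom_dim_mod M : enat :=
  esup (fun u => exists2 t, u = fin_enat t &
    exists2 I : inj_resolution M, minimal_ir I &
      forall j, (j < t)%N -> proj_mod (I j)).

End Modules.

(* Right A-modules are left modules over the converse ring. *)
Notation rmodType A := (lmodType A^c).

Section Algebras.
Variables (K : fieldType) (A : falgType K).

Definition gl_dim : enat :=
  esup (fun u => exists2 M : rmodType A, fin_gen M & u = proj_dim M).

Definition selfinjective : Prop :=
  inj_mod (A^c^o : rmodType A).

(* The infimum is taken only in the non-selfinjective case; selfinjective
   algebras get dominant dimension zero by convention. *)
Definition dom_dim : enat :=
  if `[< selfinjective >] then fin_enat 0 else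
  einf (fun u => exists2 P : rmodType A,
    proj_mod P /\ ~ inj_mod P & u = dom_dim_mod P).

Definition gorenstein : Prop :=
  forall I : rmodType A, inj_mod I -> proj_dim I <> infty.

Definition dominant_auslander_gorenstein : Prop :=
  gorenstein /\
  forall P : rmodType A, proj_mod P -> indecomposable P ->
    ele (inj_dim P) (dom_dim_mod P).

End Algebras.

Record quiver := Quiver {
  vertex : finType;
  arrow : finType;
  src : arrow -> vertex;
  tgt : arrow -> vertex;
  vertex_gt0 : (0 < #|vertex|)%N
}.

Section Paths.
Variable Q : quiver.

Fixpoint is_walk (v : vertex Q) (s : seq (arrow Q)) : bool :=
  if s is a :: s' then (src a == v) && is_walk (tgt a) s' else true.

Record qpath := QPath {
  qpath_val :> vertex Q * seq (arrow Q);
  qpathP : is_walk qpath_val.1 qpath_val.2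
}.

HB.instance Definition _ := [isSub for qpath_val].
HB.instance Definition _ := [Choice of qpath by <:].

Implicit Types p q r : qpath.

Definition qstart p : vertex Q := (val p).1.
Definition qend p : vertex Q := last (val p).1 (map (@tgt Q) (val p).2).
Definition qlen p : nat := size (val p).2.

Definition trivial_path (v : vertex Q) : qpath := @QPath (v, [::]) isT.

Lemma is_walk_cat v s1 s2 :
  is_walk v (s1 ++ s2) = is_walk v s1 && is_walk (last v (map (@tgt Q) s1)) s2.
Proof. by elim: s1 v => //= a s1 IH v; rewrite IH andbA. Qed.

Lemma qcomp_subproof p q :
  qend p = qstart q -> is_walk (val p).1 ((val p).2 ++ (val q).2).
Proof.
move=> e; rewrite is_walk_cat (qpathP p).
by move: e; rewrite /qend /= => ->; apply: (qpathP q).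
Qed.

(* Composition from left to right: first p, then q. *)
Definition qcomp p q : option qpath :=
  if qend p =P qstart q is ReflectT e
  then Some (@QPath ((val p).1, (val p).2 ++ (val q).2) (qcomp_subproof e))
  else None.

Lemma qcompP p q : qcomp p q =
  if qend p == qstart q then insub ((val p).1, (val p).2 ++ (val q).2) else None.
Proof.
rewrite /qcomp; case: eqP => // e.
by case: insubP => [u _ uv|]; [congr Some; apply: val_inj | rewrite qcomp_subproof].
Qed.

Lemma qcomp_some p q r : qcomp p q = Some r ->
  [/\ qend p = qstart q, qstart r = qstart p & qend r = qend q].
Proof.
rewrite /qcomp; case: eqP => // e [<-]; split=> //.
by rewrite /qend /= map_cat last_cat; move: e; rewrite /qend => ->.
Qed.

Lemma qcomp_none p q : qcomp p q = None -> (qend p == qstart q) = false.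
Proof. by rewrite /qcomp; case: (qend p =P qstart q) => // /eqP/negbTE. Qed.

Lemma qcompA p q r :
  obind (fun x => qcomp x r) (qcomp p q) = obind (qcomp p) (qcomp q r).
Proof.
case pq: (qcomp p q) => [x|] /=; case qr: (qcomp q r) => [y|] //=.
- have [e1 _ e2] := qcomp_some pq; have [e3 e4 _] := qcomp_some qr.
  rewrite !qcompP e2 e3 eqxx e4 e1 eqxx.
  move: pq qr; rewrite /qcomp; case: eqP => // ? [<-]; case: eqP => // ? [<-].
  by rewrite /= catA.
- by have [_ _ e2] := qcomp_some pq; rewrite qcompP e2 (qcomp_none qr).
- by have [_ e4 _] := qcomp_some qr; rewrite qcompP e4 (qcomp_none pq).
Qed.

Lemma qcomp_triv p v :
  qcomp p (trivial_path v) = if qend p == v then Some p else None.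
Proof.
rewrite /qcomp [qstart _]/=; case: eqP => // e; congr Some; apply: val_inj => /=.
by rewrite cats0; case: (qpath_val p).
Qed.

Lemma triv_qcomp p v :
  qcomp (trivial_path v) p = if v == qstart p then Some p else None.
Proof.
rewrite /qcomp [qend _]/=; case: eqP => // e; congr Some; apply: val_inj => /=.
by rewrite [v]e /qstart /=; case: (qpath_val p).
Qed.

End Paths.

(* K Q is the K-vector space with basis the paths of Q; [x@_p] is the
   coefficient of the path p in x. *)
Definition path_algebra (K : fieldType) (Q : quiver) := {malg K[qpath Q]}.

HB.instance Definition _ (K : fieldType) (Q : quiver) :=
  GRing.Lmodule.on (path_algebra K Q).

(* The three operations below are sealed to keep unification from unfolding
   finitely supported functions. *)
HB.lock Definition path_elt (K : fieldType) (Q : quiver) (p : qpath Q) :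
  path_algebra K Q := (<< p >> : {malg K[qpath Q]}).

HB.lock Definition pa_mul (K : fieldType) (Q : quiver) (x y : path_algebra K Q) :
    path_algebra K Q :=
  \sum_(p <- msupp (x : {malg K[qpath Q]}))
    \sum_(q <- msupp (y : {malg K[qpath Q]}))
      (@mcoeff (qpath Q) K p x * @mcoeff (qpath Q) K q y) *:
        oapp (@path_elt K Q) 0 (qcomp p q).

HB.lock Definition pa_one (K : fieldType) (Q : quiver) : path_algebra K Q :=
  \sum_(v : vertex Q) path_elt K (trivial_path v).

Section PathAlgebra.
Variables (K : fieldType) (Q : quiver).
Local Notation KQ := (path_algebra K Q).
Local Notation pcoef x p := (@mcoeff (qpath Q) K p x).
Local Notation path_elt := (@path_elt K Q).
Local Notation pmul p q := (oapp path_elt 0 (qcomp p q)).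
Local Notation pa_mul := (@pa_mul K Q).
Local Notation pa_one := (@pa_one K Q).

Lemma pa_mulE (d1 d2 : {fset qpath Q}) (x y : KQ) :
  (msupp x `<=` d1)%fset -> (msupp y `<=` d2)%fset ->
  pa_mul x y =
    \sum_(p <- d1) \sum_(q <- d2) (pcoef x p * pcoef y q) *: pmul p q.
Proof.
move=> le1 le2; rewrite pa_mul.unlock (big_fset_incl _ le1) /=; last first.
  move=> p _ /mcoeff_outdom px; rewrite big1 // => q _.
  by rewrite px mul0r scale0r.
apply: eq_bigr => p _; apply: (big_fset_incl _ le2) => q _ /mcoeff_outdom qy.
by rewrite qy mulr0 scale0r.
Qed.

Lemma pcoefD (x y : KQ) p : pcoef (x + y) p = pcoef x p + pcoef y p.
Proof. exact: mcoeffD. Qed.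

Lemma pcoefZ c (x : KQ) p : pcoef (c *: x) p = c * pcoef x p.
Proof. exact: mcoeffZ. Qed.

Lemma pa_mulDl : left_distributive pa_mul +%R.
Proof.
move=> x y z.
pose d := (msupp x `|` msupp y `|` msupp (x + y : {malg K[qpath Q]}))%fset.
have lx : (msupp x `<=` d)%fset by rewrite /d -fsetUA fsubsetUl.
have ly : (msupp y `<=` d)%fset.
  by rewrite /d (fsetUC (msupp x)) -fsetUA fsubsetUl.
have lxy : (msupp (x + y : {malg K[qpath Q]}) `<=` d)%fset by rewrite fsubsetUr.
rewrite (pa_mulE lxy (fsubset_refl _)) (pa_mulE lx (fsubset_refl _)).
rewrite (pa_mulE ly (fsubset_refl _)) -big_split /=; apply: eq_bigr => p _.
rewrite -big_split /=; apply: eq_bigr => q _.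
by rewrite pcoefD mulrDl scalerDl.
Qed.

Lemma pa_mulDr : right_distributive pa_mul +%R.
Proof.
move=> z x y.
pose d := (msupp x `|` msupp y `|` msupp (x + y : {malg K[qpath Q]}))%fset.
have lx : (msupp x `<=` d)%fset by rewrite /d -fsetUA fsubsetUl.
have ly : (msupp y `<=` d)%fset.
  by rewrite /d (fsetUC (msupp x)) -fsetUA fsubsetUl.
have lxy : (msupp (x + y : {malg K[qpath Q]}) `<=` d)%fset by rewrite fsubsetUr.
rewrite (pa_mulE (fsubset_refl _) lxy) (pa_mulE (fsubset_refl _) lx).
rewrite (pa_mulE (fsubset_refl _) ly) -big_split /=; apply: eq_bigr => p _.
rewrite -big_split /=; apply: eq_bigr => q _.
by rewrite pcoefD mulrDr scalerDl.
Qed.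

Lemma pa_mulZl c x y : pa_mul (c *: x) y = c *: pa_mul x y.
Proof.
rewrite (pa_mulE (msuppZ_le c x) (fsubset_refl _)) pa_mul.unlock scaler_sumr.
apply: eq_bigr => p _; rewrite scaler_sumr; apply: eq_bigr => q _.
by rewrite scalerA pcoefZ mulrA.
Qed.

Lemma pa_mulZr c x y : pa_mul x (c *: y) = c *: pa_mul x y.
Proof.
rewrite (pa_mulE (fsubset_refl _) (msuppZ_le c y)) pa_mul.unlock scaler_sumr.
apply: eq_bigr => p _; rewrite scaler_sumr; apply: eq_bigr => q _.
by rewrite scalerA pcoefZ mulrCA.
Qed.

Lemma pa_mul0l x : pa_mul 0 x = 0.
Proof. by rewrite pa_mul.unlock msupp0 big_seq_fset0. Qed.

Lemma pa_mul0r x : pa_mul x 0 = 0.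
Proof. by rewrite pa_mul.unlock big1 // => p _; rewrite msupp0 big_seq_fset0. Qed.

Lemma pa_mul_suml (I : Type) (r : seq I) (P : pred I) (F : I -> KQ) y :
  pa_mul (\sum_(i <- r | P i) F i) y = \sum_(i <- r | P i) pa_mul (F i) y.
Proof.
exact: (big_morph (pa_mul^~ y) (fun a b => pa_mulDl a b y) (pa_mul0l y)).
Qed.

Lemma pa_mul_sumr (I : Type) (r : seq I) (P : pred I) (F : I -> KQ) x :
  pa_mul x (\sum_(i <- r | P i) F i) = \sum_(i <- r | P i) pa_mul x (F i).
Proof. exact: (big_morph (pa_mul x) (pa_mulDr x) (pa_mul0r x)). Qed.

Lemma pcoef_elt p q : pcoef (path_elt p) q = (p == q)%:R.
Proof. rewrite path_elt.unlock; exact: mcoeffU. Qed.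

Lemma pa_mul_path p q : pa_mul (path_elt p) (path_elt q) = pmul p q.
Proof.
have le r : (msupp (path_elt r : {malg K[qpath Q]}) `<=` [fset r])%fset.
  by rewrite path_elt.unlock msuppU_le.
rewrite (pa_mulE (le p) (le q)) !big_seq_fset1 !pcoef_elt !eqxx mulr1.
exact: scale1r.
Qed.

Lemma path_eltE (x : KQ) :
  x = \sum_(p <- msupp (x : {malg K[qpath Q]})) pcoef x p *: path_elt p.
Proof.
rewrite {1}[x]monalgE; apply: eq_bigr => p _; apply/malgP => q.
by rewrite mcoeffZ path_elt.unlock !mcoeffU mulrnAr mulr1.
Qed.

Lemma pa_ind (P : KQ -> Prop) :
  P 0 -> (forall x y, P x -> P y -> P (x + y)) ->
  (forall c x, P x -> P (c *: x)) -> (forall p, P (path_elt p)) ->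
  forall x, P x.
Proof.
move=> P0 PD PZ Pp x; rewrite (path_eltE x); apply: big_ind => // p _.
exact/PZ/Pp.
Qed.

Lemma pa_mulA : associative pa_mul.
Proof.
move=> x y z; elim/pa_ind: x => [|x x' Hx Hx'|c x Hx|p].
- by rewrite (pa_mul0l (pa_mul y z)) (pa_mul0l y) (pa_mul0l z).
- rewrite (pa_mulDl x x' (pa_mul y z)) (pa_mulDl x x' y).
  by rewrite (pa_mulDl (pa_mul x y) (pa_mul x' y) z) Hx Hx'.
- rewrite (pa_mulZl c x (pa_mul y z)) (pa_mulZl c x y).
  by rewrite (pa_mulZl c (pa_mul x y) z) Hx.
elim/pa_ind: y => [|y y' Hy Hy'|c y Hy|q].
- by rewrite (pa_mul0l z) (pa_mul0r (path_elt p)) (pa_mul0l z).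
- rewrite (pa_mulDl y y' z) (pa_mulDr (path_elt p) (pa_mul y z) (pa_mul y' z)).
  rewrite (pa_mulDr (path_elt p) y y').
  by rewrite (pa_mulDl (pa_mul (path_elt p) y) (pa_mul (path_elt p) y') z) Hy Hy'.
- rewrite (pa_mulZl c y z) (pa_mulZr c (path_elt p) (pa_mul y z)).
  rewrite (pa_mulZr c (path_elt p) y).
  by rewrite (pa_mulZl c (pa_mul (path_elt p) y) z) Hy.
elim/pa_ind: z => [|z z' Hz Hz'|c z Hz|r].
- by rewrite (pa_mul0r (path_elt q)) (pa_mul0r (path_elt p)) pa_mul0r.
- rewrite (pa_mulDr (path_elt q) z z').
  rewrite (pa_mulDr (path_elt p) (pa_mul (path_elt q) z) (pa_mul (path_elt q) z')).
  by rewrite (pa_mulDr (pa_mul (path_elt p) (path_elt q)) z z') Hz Hz'.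
- rewrite (pa_mulZr c (path_elt q) z) (pa_mulZr c (path_elt p) (pa_mul _ z)).
  by rewrite (pa_mulZr c (pa_mul (path_elt p) (path_elt q)) z) Hz.
rewrite (pa_mul_path q r) (pa_mul_path p q); have := qcompA p q r.
case: (qcomp p q) => [a|]; case: (qcomp q r) => [b|] /= e.
- by rewrite (pa_mul_path p b) (pa_mul_path a r) e.
- by rewrite (pa_mul0r (path_elt p)) (pa_mul_path a r) e.
- by rewrite (pa_mul0l (path_elt r)) (pa_mul_path p b) -e.
- by rewrite (pa_mul0l (path_elt r)) (pa_mul0r (path_elt p)).
Qed.

Lemma pa_mul1l : left_id pa_one pa_mul.
Proof.
move=> x; elim/pa_ind: x => [|x y Hx Hy|c x Hx|p].
- exact: pa_mul0r.
- by rewrite (pa_mulDr pa_one x y) Hx Hy.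
- by rewrite (pa_mulZr c pa_one x) Hx.
rewrite pa_one.unlock pa_mul_suml (bigD1 (qstart p)) //= big1 => [|v /negbTE nv].
  by rewrite pa_mul_path triv_qcomp eqxx addr0.
by rewrite pa_mul_path triv_qcomp nv.
Qed.

Lemma pa_mul1r : right_id pa_one pa_mul.
Proof.
move=> x; elim/pa_ind: x => [|x y Hx Hy|c x Hx|p].
- exact: pa_mul0l.
- by rewrite (pa_mulDl x y pa_one) Hx Hy.
- by rewrite (pa_mulZl c x pa_one) Hx.
rewrite pa_one.unlock pa_mul_sumr (bigD1 (qend p)) //= big1 => [|v /negbTE nv].
  by rewrite pa_mul_path qcomp_triv eqxx addr0.
by rewrite pa_mul_path qcomp_triv eq_sym nv.
Qed.

Lemma pa_one_neq0 : pa_one != 0.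
Proof.
have [v _] := card_gt0P (vertex_gt0 Q).
suff H : pcoef pa_one (trivial_path v) = 1.
  apply/eqP => e; move: H; rewrite e mcoeff0 => /eqP.
  by rewrite eq_sym oner_eq0.
rewrite pa_one.unlock (raddf_sum (mcoeff (trivial_path v))) (bigD1 v) //= big1.
  by rewrite pcoef_elt eqxx addr0.
move=> w /negbTE nw; rewrite pcoef_elt; case: eqP => // e.
by move: (congr1 (@qstart Q) e) => /eqP; rewrite /qstart /= nw.
Qed.

HB.instance Definition _ := GRing.Zmodule_isNzRing.Build KQ
  pa_mulA pa_mul1l pa_mul1r pa_mulDl pa_mulDr pa_one_neq0.

Lemma path_eltM p q : path_elt p * path_elt q = pmul p q.
Proof. exact: pa_mul_path. Qed.

Lemma pa_scaleAl (c : K) (x y : KQ) : c *: (x * y) = (c *: x) * y.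
Proof. exact/esym/pa_mulZl. Qed.

Lemma pa_scaleAr (c : K) (x y : KQ) : c *: (x * y) = x * (c *: y).
Proof. exact/esym/pa_mulZr. Qed.

HB.instance Definition _ := GRing.Lmodule_isLalgebra.Build K KQ pa_scaleAl.
HB.instance Definition _ := GRing.Lalgebra_isAlgebra.Build K KQ pa_scaleAr.

(* The m-th power of the ideal generated by the arrows is spanned by the paths
   of length at least m. *)
Definition arrow_ideal_exp (m : nat) (x : KQ) : Prop :=
  forall p : qpath Q, (qlen p < m)%N -> pcoef x p = 0.

Definition two_sided_ideal (I : KQ -> Prop) : Prop :=
  [/\ I 0, forall x y, I x -> I y -> I (x + y)
    & forall a x b, I x -> I (a * x * b)].

Definition admissible (I : KQ -> Prop) : Prop :=
  [/\ two_sided_ideal I,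
      forall x, I x -> arrow_ideal_exp 2 x
    & exists2 m, (2 <= m)%N & forall x, arrow_ideal_exp m x -> I x].

(* The surjection pi with kernel I induces an isomorphism from K Q / I to A. *)
Definition is_path_quotient (A : falgType K) (I : KQ -> Prop) : Prop :=
  exists pi : {lrmorphism KQ -> A},
    surj pi /\ forall x, pi x = 0 <-> I x.

End PathAlgebra.

Lemma cycle_vertex_gt0 n : (0 < #|'I_n.+1|)%N.
Proof. by rewrite card_ord. Qed.

(* The oriented cycle with n + 1 vertices: the arrow i goes from i to
   i + 1 modulo n + 1; for n = 0 it is a loop. *)
Definition cycle_quiver (n : nat) : quiver :=
  @Quiver 'I_n.+1 'I_n.+1 id (@ordS n.+1) (cycle_vertex_gt0 n).

Definition cyclic_nakayama (K : fieldType) (A : falgType K) : Prop :=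
  exists (n : nat) (I : path_algebra K (cycle_quiver n) -> Prop),
    admissible I /\ is_path_quotient A I.

(* Main.v *)
(* With N vertices, idempotents e_a indexed by a modulo N and X the sum of the
   arrows, the uniserial modules are intervals [a, b) of integers up to translation
   by N, with a < b <= f(a), where [a, f(a)) is the projective module e_a L.  For
   g(b) = min {a | b <= f(a)} the injective hull of [a, b) is [g(b), b), so
     Omega [a, b) = [b, f(a))   and   Omega^-1 [a, b) = [g(b), a),
   and Omega^2 [a, b) = [f(a), f(b)).

   Let d be the dominant dimension, attained at P = [a, f(a)).  By the
   Auslander-Gorenstein condition J = Omega^-d P is injective, J = [g(x), x), and
   it has projective dimension d.  If d = 2k + 1, then f^(k+1) takes the same value
   at g(x) and x.  This makes the global dimension finite: the syzygies of [s_0, s_1)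
   are the intervals [s_j, s_(j+1)) with s_(j+2) = f(s_j); after translating J, let j
   be least with g(x) <= s_j, so that s_(j-1) < g(x), that is s_(j+1) < x.  Then
   f^(k+1) identifies s_j and s_(j+1), so the syzygies vanish after a number of
   steps bounded independently of [s_0, s_1). *)
From HB Require Import structures.
Require Import Defs.
From mathcomp Require Import all_boot all_order all_algebra all_field.
From mathcomp Require Import generic_quotient ring_quotient.
From mathcomp Require Import zify boolp.
Set Implicit Arguments.
Unset Strict Implicit.
Unset Printing Implicit Defensive.
Import Order.TTheory GRing.Theory Num.Theory.
Local Open Scope ring_scope.

(** Parity enters through the start of the coresolution. With T_0 = f(a), T_1 = a and T_(j+2) =
    g(T_j), the j-th cosyzygy of P is [T_(j+1), T_j). Its hull [T_(j+2), T_j) is projective exactly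
    when f(T_(j+2)) = T_j, so f undoes g up to step d. Injectivity of J says x = T_d and g(x) =
    T_(d+1). For d odd, powers of f bring these two back to T_1 and T_2, which f identifies because
    f(g(f(a))) = f(a); for d even they come back to T_0 and T_1, and f(T_0) > f(T_1).

    Finiteness of d has the same source. By periodicity a single power of f already makes every
    identification that any power makes; an endless projective coresolution would then give T_1 =
    T_2, that is, P injective.

    The obstacle is that the dimensions refer to unspecified injective resolutions, whereas T
    describes one coresolution. Cosyzygies taken through projective-injective modules are therefore
    compared with those of any injective resolution by the dual of Schanuel's lemma, up to
    projective-injective summands. This yields both the upper bound on the dominant dimension and
    the injectivity of J. *)

Section Generic.
Variable R : nzRingType.
Implicit Types M N Q X Y Z P I : lmodType R.

Lemma mk_linear M N (h : M -> N) : linear h -> {k : {linear M -> N} | forall x, k x = h x}.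
Proof.
move=> hl; pose k : {linear M -> N} := HB.pack h (GRing.isLinear.Build R M N *:%R h hl).
by exists k.
Qed.

Lemma linear_factor M N Q (p : {linear M -> Q}) (h : {linear M -> N}) :
  surj p -> (forall x, p x = 0 -> h x = 0) ->
  exists k : {linear Q -> N}, forall x, k (p x) = h x.
Proof.
move=> ps ph; have [s sK] := choice ps.
have hs x : h (s (p x)) = h x.
  by apply/eqP; rewrite -subr_eq0 -linearB ph // linearB sK subrr.
have [|k kE] := @mk_linear _ _ (fun q => h (s q)).
  move=> c x y; rewrite -linearP; apply/eqP; rewrite -subr_eq0 -linearB ph //.
  by rewrite linearB linearP !sK subrr.
by exists k => x; rewrite kE.
Qed.

End Generic.

(** * Submodules, quotients and finitely generated modules *)

Section Submodule.
Variables (R : nzRingType) (M : lmodType R) (S : {pred M}).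
Hypothesis Sc : submod_closed S.

(** The closure proof is a phantom argument: it stays visible in the type, so that the instances
    below can recover it. [zmod_closed_of_submod] uses the same device. *)
Definition submodule of submod_closed S := {x : M | x \in S}.

HB.instance Definition _ := [isSub of submodule Sc for @sval _ _].
HB.instance Definition _ := [Choice of submodule Sc by <:].
HB.instance Definition _ := GRing.SubChoice_isSubZmodule.Build M S (submodule Sc)
  (GRing.submod_closedB Sc).
HB.instance Definition _ := GRing.SubZmodule_isSubLmodule.Build R M S (submodule Sc)
  (GRing.submod_closed_semi Sc).

Definition submodule_val : {linear submodule Sc -> M} := val.

End Submodule.

Section Quotient.
Variables (R : nzRingType) (M : lmodType R) (S : {pred M}).
Hypothesis Sc : submod_closed S.

Definition zmod_closed_of_submod of submod_closed S := S.
HB.instance Definition _ := GRing.isZmodClosed.Build M (zmod_closed_of_submod Sc)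
  (GRing.submod_closedB Sc).

Definition quotient_mod := Quotient.quot (zmod_closed_of_submod Sc).
HB.instance Definition _ := GRing.Zmodule.on quotient_mod.

Definition quotient_pi (x : M) : quotient_mod := (\pi_(quotient_mod) x)%qT.

Lemma quotient_pi_eq x y : (quotient_pi x == quotient_pi y) = (x - y \in S).
Proof. by rewrite -(@Quotient.idealrBE _ (zmod_closed_of_submod Sc)). Qed.

Lemma quotient_piD x y : quotient_pi (x + y) = quotient_pi x + quotient_pi y.
Proof. exact: (@pi_addr _ _ _ _ _ (Quotient.quot (zmod_closed_of_submod Sc))). Qed.

Lemma quotient_pi_surj q : exists x, q = quotient_pi x.
Proof. by exists (repr q); rewrite /quotient_pi reprK. Qed.

Definition quotient_scale (c : R) (q : quotient_mod) : quotient_mod :=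
  quotient_pi (c *: repr q).

Lemma quotient_piZ c x : quotient_pi (c *: x) = quotient_scale c (quotient_pi x).
Proof.
apply/eqP; rewrite quotient_pi_eq -scalerBr.
suff xS : x - repr (quotient_pi x) \in S.
  by have [_ SZ] := GRing.submod_closed_semi Sc; exact: SZ.
by rewrite -quotient_pi_eq /quotient_pi reprK.
Qed.

Lemma quotient_scaleA a b q :
  quotient_scale a (quotient_scale b q) = quotient_scale (a * b) q.
Proof. by have [x ->] := quotient_pi_surj q; rewrite -!quotient_piZ scalerA. Qed.
Lemma quotient_scale1 : left_id 1 quotient_scale.
Proof. by move=> q; have [x ->] := quotient_pi_surj q; rewrite -quotient_piZ scale1r. Qed.
Lemma quotient_scaleDr : right_distributive quotient_scale +%R.
Proof.
move=> c q q'; have [[x ->] [y ->]] := (quotient_pi_surj q, quotient_pi_surj q').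
by rewrite -quotient_piD -!quotient_piZ scalerDr quotient_piD.
Qed.
Lemma quotient_scaleDl q : {morph quotient_scale^~ q : a b / a + b}.
Proof.
by move=> a b; have [x ->] := quotient_pi_surj q; rewrite -!quotient_piZ scalerDl quotient_piD.
Qed.

HB.instance Definition _ := GRing.Zmodule_isLmodule.Build R quotient_mod
  quotient_scaleA quotient_scale1 quotient_scaleDr quotient_scaleDl.

End Quotient.

Section Closed.
Variables (R : nzRingType).
Implicit Types M N Q X Y Z P I : lmodType R.

Definition submod M (S : M -> Prop) : Prop :=
  S 0 /\ forall c x y, S x -> S y -> S (c *: x + y).

Lemma submodP M (S : M -> Prop) : submod S ->
  exists2 p : {pred M}, submod_closed p & forall x, x \in p <-> S x.
Proof.
move=> [S0 SD]; exists (fun x => `[< S x >]); last first.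
  by move=> x; rewrite unfold_in; split=> /asboolP.
split=> [|c x y]; rewrite !unfold_in; first exact/asboolP.
by move=> /asboolP ? /asboolP ?; apply/asboolP/SD.
Qed.

Lemma ex_submodule M (S : M -> Prop) : submod S ->
  exists (Q : lmodType R) (i : {linear Q -> M}),
    injective i /\ forall x, (exists q, i q = x) <-> S x.
Proof.
move=> /submodP [p pc pS]; exists (submodule pc : lmodType R), (submodule_val pc).
split=> [|x]; first exact: val_inj.
split=> [[q <-]|/pS xp]; first exact/pS/(valP q).
by exists (exist _ x xp : submodule pc).
Qed.

Lemma ex_quotient M (S : M -> Prop) : submod S ->
  exists (Q : lmodType R) (p : {linear M -> Q}),
    surj p /\ forall x, p x = 0 <-> S x.
Proof.
move=> /submodP [p pc pS]; have [|q qE] := @mk_linear R M (quotient_mod pc) (quotient_pi pc).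
  by move=> c x y; rewrite quotient_piD quotient_piZ.
exists (quotient_mod pc : lmodType R), q; split=> [y|x].
  by have [x ->] := quotient_pi_surj y; exists x.
rewrite -pS -[x in X in _ <-> X]subr0 -quotient_pi_eq -!qE linear0.
by split=> /eqP.
Qed.

Definition iso M N := exists f : {linear M -> N}, bijective f.

Lemma bij_linear_inv M N (f : {linear M -> N}) : bijective f ->
  exists g : {linear N -> M}, cancel f g /\ cancel g f.
Proof.
case=> g fK gK; have [|k kE] := @mk_linear _ _ _ g.
  by move=> c x y; apply: (can_inj fK); rewrite linearP !gK.
by exists k; split=> x; rewrite kE.
Qed.

Lemma inj_surj_bij (S T : Type) (f : S -> T) : injective f -> surj f -> bijective f.
Proof.
move=> fi /choice [g gK]; exists g => // x; exact: fi.
Qed.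

Lemma iso_sym M N : iso M N -> iso N M.
Proof. by case=> f /bij_linear_inv [g [fK gK]]; exists g; exists f. Qed.

Lemma iso_trans M N Q : iso M N -> iso N Q -> iso M Q.
Proof.
case=> f fb [g gb]; exists (g \o f : {linear M -> Q}); exact: bij_comp.
Qed.

Lemma injective0 M N (f : {linear M -> N}) :
  injective f <-> forall x, f x = 0 -> x = 0.
Proof.
split=> [fi x fx|f0 x y fxy]; first by apply: fi; rewrite fx linear0.
by apply/eqP; rewrite -subr_eq0; apply/eqP/f0; rewrite linearB fxy subrr.
Qed.

(** Direct summands without a named complement; projectivity and injectivity pass along retracts. *)
Definition retract M N :=
  exists (i : {linear M -> N}) (r : {linear N -> M}), forall x, r (i x) = x.

Lemma iso_retract M N : iso M N -> retract M N.
Proof. by case=> f /bij_linear_inv [g [fK _]]; exists f, g. Qed.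

Lemma ex_pair M N Q (f : {linear Q -> M}) (g : {linear Q -> N}) :
  exists h : {linear Q -> (M * N)%type}, forall x, h x = (f x, g x).
Proof.
have [|k kE] := @mk_linear R Q (M * N)%type (fun x => (f x, g x)); last by exists k.
by move=> c x y; rewrite !linearP.
Qed.

Lemma ex_copair M N Q (f : {linear M -> Q}) (g : {linear N -> Q}) :
  exists h : {linear (M * N)%type -> Q}, forall x, h x = f x.1 + g x.2.
Proof.
have [|k kE] := @mk_linear R (M * N)%type Q (fun x => f x.1 + g x.2); last by exists k.
by move=> c [x1 x2] [y1 y2] /=; rewrite !linearP scalerDr addrACA.
Qed.

Lemma ex_prod_map M N M' N' (f : {linear M -> M'}) (g : {linear N -> N'}) :
  exists h : {linear (M * N)%type -> (M' * N')%type}, forall x, h x = (f x.1, g x.2).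
Proof.
by have [h hE] := ex_pair (f \o fst : {linear (M * N)%type -> M'})
  (g \o snd : {linear (M * N)%type -> N'}); exists h.
Qed.

Lemma fin_genP M : fin_gen M <->
  exists n (p : {linear 'rV[R]_n -> M}), surj p.
Proof.
split=> [[s sP]|[n [p ps]]].
  have [|k kE] := @mk_linear R 'rV[R]_(size s) M (fun v => \sum_i v 0 i *: s`_i).
    move=> c x y; rewrite scaler_sumr -big_split /=; apply: eq_bigr => i _.
    by rewrite !mxE scalerDl scalerA.
  exists (size s), k => x; have [c ->] := sP x.
  by exists (\row_i c i); rewrite kE; apply: eq_bigr => i _; rewrite mxE.
exists [seq p (delta_mx 0 i) | i : 'I_n] => x.
have [v <-] := ps x.
have sz : size [seq p (delta_mx 0 i) | i : 'I_n] = n by rewrite size_map size_enum_ord.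
exists (fun i => v 0 (cast_ord sz i)).
rewrite {1}[v]row_sum_delta linear_sum /=.
rewrite (reindex (cast_ord sz)) /=; last first.
  by exists (cast_ord (esym sz)) => i _; [exact: cast_ordK | exact: cast_ordKV].
apply: eq_bigr => i _; rewrite linearZ; congr (_ *: _).
have lt : (i < n)%N := ltn_ord (cast_ord sz i).
rewrite (nth_map (cast_ord sz i)) ?size_enum_ord //.
by congr (p (delta_mx 0 _)); apply: val_inj; rewrite /= nth_enum_ord.
Qed.

Lemma fin_gen_surj M N (f : {linear M -> N}) : surj f -> fin_gen M -> fin_gen N.
Proof.
move=> fs /fin_genP [n [p ps]]; apply/fin_genP.
exists n, (f \o p : {linear 'rV[R]_n -> N}) => y.
by have [x <-] := fs y; have [v <-] := ps x; exists v.
Qed.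

Lemma fin_gen_retract M N : retract M N -> fin_gen N -> fin_gen M.
Proof. by case=> i [r rK]; apply: (@fin_gen_surj _ _ r) => x; exists (i x). Qed.

Lemma fin_gen_prod M N : fin_gen M -> fin_gen N -> fin_gen (M * N)%type.
Proof.
move=> /fin_genP [m [p ps]] /fin_genP [n [q qs]]; apply/fin_genP.
have [h hE] := ex_pair (p \o lsubmx : {linear 'rV[R]_(m + n) -> M})
  (q \o rsubmx : {linear 'rV[R]_(m + n) -> N}).
exists (m + n)%N, h => -[x y]; have [[u <-] [v <-]] := (ps x, qs y).
by exists (row_mx u v); rewrite hE /= row_mxKl row_mxKr.
Qed.

Lemma fin_gen_zero M : zero_mod M -> fin_gen M.
Proof.
move=> M0; exists [::] => x; exists (fun=> 0).
exact: etrans (M0 _) (esym (M0 _)).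
Qed.

End Closed.

(** * Projective and injective modules *)

Section ProjInj.
Variables (R : nzRingType).
Implicit Types M N Q X Y Z P I : lmodType R.

Lemma linear_lift_inj M N Q (i : {linear N -> Q}) (h : {linear M -> Q}) :
  injective i -> (forall x, exists y, i y = h x) ->
  exists k : {linear M -> N}, forall x, i (k x) = h x.
Proof.
move=> ii /choice [s sE].
have [|k kE] := @mk_linear R M N s; last by exists k => x; rewrite kE.
by move=> c x y; apply: ii; rewrite linearP !sE linearP.
Qed.

Lemma ex_null M N : exists h : {linear M -> N}, forall x, h x = 0.
Proof.
have [|k kE] := @mk_linear R M N (fun=> 0); last by exists k.
by move=> c x y; rewrite scaler0 addr0.
Qed.

Lemma proj_mod_retract M P : retract M P -> proj_mod P -> proj_mod M.
Proof.
move=> rMP [Pf Pl]; split; first exact: fin_gen_retract rMP Pf.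
case: rMP => i [r rK] X Y g f Xf Yf gs.
have [h hE] := Pl X Y g (f \o r : {linear P -> Y}) Xf Yf gs.
by exists (h \o i : {linear M -> X}) => x; rewrite /= hE /= rK.
Qed.

Lemma inj_mod_retract M I : retract M I -> inj_mod I -> inj_mod M.
Proof.
move=> rMI [If Ie]; split; first exact: fin_gen_retract rMI If.
case: rMI => i [r rK] X Y g f Xf Yf gi.
have [h hE] := Ie X Y g (i \o f : {linear X -> I}) Xf Yf gi.
by exists (r \o h : {linear Y -> M}) => x; rewrite /= hE /= rK.
Qed.

Lemma proj_mod_prod M N : proj_mod M -> proj_mod N -> proj_mod (M * N)%type.
Proof.
move=> [Mf Ml] [Nf Nl]; split; first exact: fin_gen_prod.
move=> X Y g f Xf Yf gs.
have [in1 in1E] := ex_pair (idfun : {linear M -> M}) (sval (cid (ex_null M N))).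
have [in2 in2E] := ex_pair (sval (cid (ex_null N M))) (idfun : {linear N -> N}).
have [h1 h1E] := Ml X Y g (f \o in1 : {linear M -> Y}) Xf Yf gs.
have [h2 h2E] := Nl X Y g (f \o in2 : {linear N -> Y}) Xf Yf gs.
have [h hE] := ex_copair h1 h2.
exists h => -[x y]; rewrite hE linearD h1E h2E /= in1E in2E -linearD /=.
rewrite (svalP (cid (ex_null M N))) (svalP (cid (ex_null N M))).
by congr (f (_, _)); rewrite /= ?addr0 ?add0r.
Qed.

Lemma inj_mod_prod M N : inj_mod M -> inj_mod N -> inj_mod (M * N)%type.
Proof.
move=> [Mf Me] [Nf Ne]; split; first exact: fin_gen_prod.
move=> X Y g f Xf Yf gi.
have [h1 h1E] := Me X Y g (fst \o f : {linear X -> M}) Xf Yf gi.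
have [h2 h2E] := Ne X Y g (snd \o f : {linear X -> N}) Xf Yf gi.
have [h hE] := ex_pair h1 h2.
by exists h => x; rewrite hE h1E h2E /=; case: (f x).
Qed.

Lemma proj_mod_zero M : zero_mod M -> proj_mod M.
Proof.
move=> M0; split=> [|X Y g f _ _ _]; first exact: fin_gen_zero.
by have [h hE] := ex_null M X; exists h => x; rewrite (M0 x) !linear0.
Qed.

Lemma inj_mod_zero M : zero_mod M -> inj_mod M.
Proof.
move=> M0; split=> [|X Y g f _ _ _]; first exact: fin_gen_zero.
by have [h hE] := ex_null Y M; exists h => x; rewrite (M0 (f x)) (M0 (h _)).
Qed.

Lemma zero_mod_rV0 : zero_mod 'rV[R]_0.
Proof. by move=> x; apply: thinmx0. Qed.

Definition ses X Y Z (i : {linear X -> Y}) (p : {linear Y -> Z}) :=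
  [/\ injective i, surj p & exact_at i p].

Lemma ex_kernel Y Z (p : {linear Y -> Z}) : surj p ->
  exists X (i : {linear X -> Y}), ses i p.
Proof.
move=> ps; have [|X [i [ii iE]]] := @ex_submodule R Y (fun y => p y = 0).
  by split=> [|c x y px py]; rewrite ?linear0 // linearP px py scaler0 addr0.
by exists X, i; split=> // y; rewrite iE.
Qed.

Lemma ses_section X Y Z (i : {linear X -> Y}) (p : {linear Y -> Z}) (s : {linear Z -> Y}) :
  ses i p -> (forall z, p (s z) = z) -> iso Y (Z * X)%type.
Proof.
move=> [ii ps ip] sK.
have [k kE] : exists k : {linear Y -> X}, forall y, i (k y) = y - s (p y).
  have [|h hE] := @mk_linear R Y Y (fun y => y - s (p y)).
    by move=> c x y; rewrite [p _]linearP [s _]linearP scalerBr opprD addrACA.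
  have [|k kE] := linear_lift_inj ii (h := h); last by exists k => y; rewrite kE hE.
  by move=> x; apply/ip; rewrite hE linearB sK subrr.
have [h hE] := ex_pair p k; exists h; apply: inj_surj_bij.
  apply/injective0 => y; rewrite hE => -[py ky].
  by have := kE y; rewrite ky py !linear0 addr0.
case=> z x; exists (s z + i x); rewrite hE.
have pix : p (i x) = 0 by apply/ip; exists x.
congr (_, _); first by rewrite linearD sK pix addr0.
by apply: ii; rewrite kE linearD sK pix addr0 addrC addKr.
Qed.

Lemma proj_ses_split X Y Z (i : {linear X -> Y}) (p : {linear Y -> Z}) :
  ses i p -> fin_gen Y -> proj_mod Z -> iso Y (Z * X)%type.
Proof.
move=> ip Yf [Zf Zl]; have [_ ps _] := ip.
have [s sK] := Zl Y Z p (idfun : {linear Z -> Z}) Yf Zf ps.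
exact: (ses_section ip sK).
Qed.

Inductive dsum (B : lmodType R -> Prop) : lmodType R -> Prop :=
| dsum_zero M of zero_mod M : dsum B M
| dsum_cons M X Y of B X & dsum B Y & iso M (X * Y)%type : dsum B M.

Lemma dsum_iso B M N : iso M N -> dsum B N -> dsum B M.
Proof.
move=> MN dN; case: dN MN => {N} [N N0|N X Y BX BY NXY] MN; last first.
  exact: dsum_cons BX BY (iso_trans MN NXY).
apply: dsum_zero => x; case: MN => f /bij_inj fi; apply: fi.
by rewrite linear0; apply: N0.
Qed.

Lemma dsum_inj B M : (forall X, B X -> inj_mod X) -> dsum B M -> inj_mod M.
Proof.
move=> Bi; elim=> {M} [M|M X Y BX _ IH MXY]; first exact: inj_mod_zero.
exact: inj_mod_retract (iso_retract MXY) (inj_mod_prod (Bi _ BX) IH).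
Qed.

Lemma dsum_sub B B' M : (forall X, B X -> B' X) -> dsum B M -> dsum B' M.
Proof.
move=> BB'; elim=> {M} [M M0|M X Y BX _ IH MXY]; first exact: dsum_zero.
exact: dsum_cons (BB' _ BX) IH MXY.
Qed.

(** Serves to find an indecomposable summand of a projective module on which the socle of an
    embedded uniserial module survives. *)
Lemma dsum_detect B M N (h : {linear N -> M}) (w : N) :
  dsum B M -> h w != 0 -> exists X (k : {linear N -> X}), B X /\ k w != 0.
Proof.
move=> dM; elim: dM h => {M} [M M0|M X Y BX _ IH [f fb]] h hw.
  by move: hw; rewrite (M0 (h w)) eqxx.
have [fw|fw] := eqVneq (f (h w)).1 0; last first.
  by exists X, (fst \o (f \o h) : {linear N -> X}).
apply: (IH (snd \o (f \o h) : {linear N -> Y})); apply: contra hw => /eqP /= fw2.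
apply/eqP/(bij_inj fb); rewrite linear0 [LHS]surjective_pairing.
by rewrite fw fw2.
Qed.

End ProjInj.

(** * Resolutions *)

Section Resolutions.
Variables (R : nzRingType).
Implicit Types M N Q X Y Z P I K : lmodType R.

(** Only upper bounds on projective dimension are wanted, so each step may use any projective
    presentation, minimal or not. *)
Fixpoint proj_dim_le n M : Prop :=
  if n is n'.+1 then
    exists P K (i : {linear K -> P}) (p : {linear P -> M}),
      [/\ proj_mod P, ses i p & proj_dim_le n' K]
  else proj_mod M.

Lemma ses_id M : exists (i : {linear 'rV[R]_0 -> M}), ses i (idfun : {linear M -> M}).
Proof.
have [h hE] := ex_null 'rV[R]_0 M; exists h; split.
- by apply/injective0 => x _; apply: zero_mod_rV0.
- by move=> x; exists x.
- move=> y; split=> /= [->|[x <-]]; last exact: hE.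
  by exists 0; rewrite linear0.
Qed.

Lemma proj_dim_leS n M : proj_dim_le n M -> proj_dim_le n.+1 M.
Proof.
elim: n M => [|n IH] M /= Mn.
  have [i iE] := ses_id M; exists M, _, i, idfun; split=> //.
  exact/proj_mod_zero/zero_mod_rV0.
by case: Mn => P [K [i [p [PP ip /IH Kn]]]]; exists P, K, i, p.
Qed.

Lemma proj_dim_le_leq m n M : (m <= n)%N -> proj_dim_le m M -> proj_dim_le n M.
Proof. by move=> /subnK <- Mm; elim: (n - m)%N => //= k; apply: proj_dim_leS. Qed.

Lemma rV_lift n Y Z (p : {linear Y -> Z}) (f : {linear 'rV[R]_n -> Z}) :
  surj p -> exists h : {linear 'rV[R]_n -> Y}, forall v, p (h v) = f v.
Proof.
move=> ps; have /choice [s sE] : forall i, exists y, p y = f (delta_mx 0 i).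
  by move=> i; apply: ps.
have [|h hE] := @mk_linear R 'rV[R]_n Y (fun v => \sum_i v 0 i *: s i).
  move=> c x y; rewrite scaler_sumr -big_split /=; apply: eq_bigr => i _.
  by rewrite !mxE scalerDl scalerA.
exists h => v; rewrite [in RHS](row_sum_delta v) hE !linear_sum.
by apply: eq_bigr => i _; rewrite !linearZ sE.
Qed.

Lemma fin_gen_ses X Y Z (i : {linear X -> Y}) (p : {linear Y -> Z}) :
  ses i p -> fin_gen X -> fin_gen Z -> fin_gen Y.
Proof.
move=> [ii ps e] Xf /fin_genP [n [f fs]]; have [h hE] := rV_lift f ps.
have Ff : fin_gen 'rV[R]_n by apply/fin_genP; exists n, idfun => x; exists x.
have [q qE] := ex_copair i h.
apply: (fin_gen_surj (f := q) _ (fin_gen_prod Xf Ff)) => y.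
have [v vE] := fs (p y).
have /e [x xE] : p (y - h v) = 0 by rewrite linearB hE vE subrr.
by exists (x, v); rewrite qE /= xE subrK.
Qed.

Lemma proj_dim_le_fin_gen n M : proj_dim_le n M -> fin_gen M.
Proof.
case: n => [|n] /=; first by case.
by case=> P [K [i [p [[Pf _] [_ ps _] _]]]]; apply: fin_gen_surj ps Pf.
Qed.

(** The horseshoe lemma: [P1 * P2] covers [Y] through a lift of [p2] along [p], and the three
    kernels again form a short exact sequence, to which the induction applies. *)
Lemma proj_dim_le_ses n X Y Z (i : {linear X -> Y}) (p : {linear Y -> Z}) :
  ses i p -> proj_dim_le n X -> proj_dim_le n Z -> proj_dim_le n Y.
Proof.
elim: n X Y Z i p => [|n IH] X Y Z i p ip Xn Zn.
  have Yf := fin_gen_ses ip Xn.1 Zn.1; move: Xn Zn => Xp Zp.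
  have YZX := proj_ses_split ip Yf Zp.
  exact: proj_mod_retract (iso_retract YZX) (proj_mod_prod Zp Xp).
have Yf := fin_gen_ses ip (proj_dim_le_fin_gen Xn) (proj_dim_le_fin_gen Zn).
case: Xn => P1 [K1 [i1 [p1 [P1p [i1i p1s e1] K1n]]]].
case: Zn => P2 [K2 [i2 [p2 [P2p [i2i p2s e2] K2n]]]].
have [ii ps e] := ip.
have [s sE] : exists s : {linear P2 -> Y}, forall x, p (s x) = p2 x.
  by apply: P2p.2 => //; apply: fin_gen_surj ps Yf.
have [q qE] := ex_copair (i \o p1 : {linear P1 -> Y}) s.
have pi x : p (i x) = 0 by apply/e; exists x.
have qs : surj q.
  move=> y; have [x2 x2E] := p2s (p y).
  have /e [x xE] : p (y - s x2) = 0 by rewrite linearB sE x2E subrr.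
  have [x1 x1E] := p1s x.
  by exists (x1, x2); rewrite qE /= x1E xE subrK.
have [K [j jq]] := ex_kernel qs; have [ji _ ej] := jq.
exists (P1 * P2)%type, K, j, q; split=> //; first exact: proj_mod_prod.
have jK k : i (p1 (j k).1) + s (j k).2 = 0 by rewrite -[LHS]qE; apply/ej; exists k.
have [b bE] : exists b : {linear K -> K2}, forall k, i2 (b k) = (j k).2.
  apply: (linear_lift_inj i2i (h := snd \o j : {linear K -> P2})) => k; apply/e2.
  by have := congr1 p (jK k); rewrite linearD pi sE add0r linear0.
have [in1 in1E] := ex_pair i1 (sval (cid (ex_null K1 P2))).
have [a aE] : exists a : {linear K1 -> K}, forall x, j (a x) = in1 x.
  apply: (linear_lift_inj ji) => x; apply/ej.
  rewrite in1E qE /= (svalP (cid (ex_null K1 P2))) linear0 addr0.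
  have -> : p1 (i1 x) = 0 by apply/e1; exists x.
  exact: linear0.
have in1E' x : in1 x = (i1 x, 0) by rewrite in1E (svalP (cid (ex_null K1 P2))).
apply: (IH _ _ _ a b) => //; split.
- apply/injective0 => x ax; apply: i1i; rewrite linear0.
  by have := congr1 fst (aE x); rewrite ax linear0 in1E'.
- move=> z; have pz : p (s (i2 z)) = 0 by rewrite sE; apply/e2; exists z.
  have /e [x xE] := pz; have [x1 x1E] := p1s x.
  have /ej [k kE] : q (- x1, i2 z) = 0.
    by rewrite qE /= linearN x1E linearN xE addNr.
  by exists k; apply: i2i; rewrite bE kE.
- move=> k; split=> [bk|[x <-]]; last first.
    by apply: i2i; rewrite bE aE in1E' linear0.
  have k2 : (j k).2 = 0 by rewrite -bE bk linear0.
  have /e1 [x xE] : p1 (j k).1 = 0.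
    by apply: ii; rewrite linear0 -(jK k) k2 linear0 addr0.
  by exists x; apply: ji; rewrite aE in1E' [RHS]surjective_pairing k2 xE.
Qed.

Lemma ex_zero_proj_resolution M : zero_mod M ->
  exists P : proj_resolution M, forall j, zero_mod (P j).
Proof.
move=> M0; pose Z : lmodType R := 'rV[R]_0.
have Z0 : zero_mod Z := @zero_mod_rV0 R.
have [a _] := ex_null Z M; have [d _] := ex_null Z Z.
unshelve eexists (@ProjResolution R M (fun=> Z) a (fun=> d) _ _ _ _) => //=.
- by move=> _; apply: proj_mod_zero.
- by move=> y; exists 0; rewrite (M0 y) (M0 (a 0)).
- by move=> y; split=> _; rewrite ?(M0 (a y)) //; exists 0; rewrite (Z0 y) (Z0 (d 0)).
- by move=> _ y; split=> _; rewrite ?(Z0 (d y)) //; exists 0; rewrite (Z0 y) (Z0 (d 0)).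
Qed.

Lemma proj_resolution_cons M P K (i : {linear K -> P}) (p : {linear P -> M})
    (Q : proj_resolution K) : proj_mod P -> ses i p ->
  exists S : proj_resolution M, forall j, S j.+1 = Q j.
Proof.
move=> Pp [ii ps e]; case: Q => Qm Qa Qd Qp Qs Qe0 QeS.
pose S j := if j is k.+1 then Qm k else P.
pose d j : {linear S j.+1 -> S j} :=
  match j return {linear S j.+1 -> S j} with
  | 0 => (i \o Qa : {linear Qm 0 -> P})
  | k.+1 => Qd k
  end.
unshelve eexists (@ProjResolution R M S p d _ _ _ _) => //=.
- by case.
- move=> y; rewrite e; split=> [[x <-]|[x <-]]; last by exists (Qa x).
  by have [z <-] := Qs x; exists z.
- case=> [|k] //= y; rewrite -Qe0 /=; split=> [Qy|->]; last exact: linear0.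
  by apply: ii; rewrite Qy linear0.
Qed.

Lemma ele_proj_dim n M : proj_dim_le n M -> ele (proj_dim M) (fin_enat n).
Proof.
move=> Mn; apply: einf_lb; exists n => //.
elim: n M Mn => [|n IH] M.
  move=> Mp; have [i iE] := ses_id M.
  have [Q Q0] := ex_zero_proj_resolution (@zero_mod_rV0 R).
  have [S SE] := proj_resolution_cons Q Mp iE.
  by exists S; case=> // j _; rewrite SE; apply: Q0.
case=> P [K [i [p [Pp ip /IH [Q Q0]]]]].
have [S SE] := proj_resolution_cons Q Pp ip.
by exists S; case=> // j jn; rewrite SE; apply: Q0.
Qed.

End Resolutions.

(** * Minimal injective coresolutions and comparison of cosyzygies *)

Section InjectiveResolutions.
Variables (R : nzRingType).
Implicit Types M N Q X Y Z P I K E : lmodType R.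

(** With its converse below, this reduces essentiality to cyclic submodules, a form that can be
    checked on products. *)
Lemma essential_imageI X Y (f : {linear X -> Y}) :
  (forall y, y != 0 -> exists r x, f x = r *: y /\ r *: y != 0) ->
  essential_image f.
Proof.
move=> fe S /GRing.submod_closed_semi [_ SZ] [y Sy /fe [r [x [fx ry]]]].
by exists x; rewrite fx // SZ.
Qed.

Lemma essential_imageE X Y (f : {linear X -> Y}) : essential_image f ->
  forall y, y != 0 -> exists r x, f x = r *: y /\ r *: y != 0.
Proof.
move=> fe y y0; have [|p pc pS] := @submodP R Y (fun z => exists r, z = r *: y).
  split=> [|c _ _ [r ->] [s ->]]; first by exists 0; rewrite scale0r.
  by exists (c * r + s); rewrite scalerDl scalerA.
have [|x /pS [r fx] fx0] := fe p pc.
  by exists y => //; apply/pS; exists 1; rewrite scale1r.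
by exists r, x; rewrite -fx.
Qed.

(** One step of a minimal coresolution: [k] counts the terms still required to be projective, and
    [C] is the invariant handed on to the cosyzygy. *)
Definition cosyz_step k M (C : lmodType R -> Prop) : Prop :=
  exists I M' (i : {linear M -> I}) (p : {linear I -> M'}),
    [/\ ses i p, inj_mod I, essential_image i,
        (0 < k)%N -> proj_mod I & C M'].

Lemma cosyz_step_zero k M C : zero_mod M -> (forall Z, zero_mod Z -> C Z) ->
  cosyz_step k M C.
Proof.
move=> M0 C0; have [h hE] := ex_null M M; exists M, M, idfun, h; split.
- split=> // [y|y]; first by exists 0; rewrite (M0 y) linear0.
  by split=> [_|_]; [exists y | exact: hE].
- exact: inj_mod_zero.
- by move=> S _ [y Sy y0]; exists y.
- by move=> _; apply: proj_mod_zero.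
- exact: C0.
Qed.

Lemma ses_prod X Y Z X' Y' Z' (i : {linear X -> Y}) (p : {linear Y -> Z})
    (i' : {linear X' -> Y'}) (p' : {linear Y' -> Z'})
    (j : {linear (X * X')%type -> (Y * Y')%type})
    (q : {linear (Y * Y')%type -> (Z * Z')%type}) :
  (forall x, j x = (i x.1, i' x.2)) -> (forall y, q y = (p y.1, p' y.2)) ->
  ses i p -> ses i' p' -> ses j q.
Proof.
move=> jE qE [ii ps e] [ii' ps' e']; split.
- by move=> [x x'] [y y']; rewrite !jE => -[/ii -> /ii' ->].
- move=> [z z']; have [[y <-] [y' <-]] := (ps z, ps' z').
  by exists (y, y'); rewrite qE.
- move=> [y y']; rewrite qE /=; split=> [[/e [x <-] /e' [x' <-]]|[[x x']]].
    by exists (x, x'); rewrite jE.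
  rewrite jE => -[<- <-]; have -> : p (i x) = 0 by apply/e; exists x.
  by have -> : p' (i' x') = 0 by apply/e'; exists x'.
Qed.

Lemma cosyz_step_prod k M N (C D F : lmodType R -> Prop) :
  cosyz_step k M C -> cosyz_step k N D ->
  (forall X Y, C X -> D Y -> F (X * Y)%type) -> cosyz_step k (M * N)%type F.
Proof.
case=> I [M' [i [p [ip Ii ie Ip CM]]]] [J [N' [j [q [jq Ji je Jp DN]]]]] CDF.
have [a aE] := ex_prod_map i j; have [b bE] := ex_prod_map p q.
exists (I * J)%type, (M' * N')%type, a, b; split.
- exact: ses_prod aE bE ip jq.
- exact: inj_mod_prod.
- apply: essential_imageI => -[y z] yz0.
  have [y0|/(essential_imageE ie) [r [x [ix ry0]]]] := eqVneq y 0.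
    have /(essential_imageE je) [r [x [jx rz0]]] : z != 0.
      by move: yz0; apply: contra => /eqP ->; rewrite y0.
    exists r, (0, x); rewrite aE /= linear0 jx y0.
    split; first by congr (_, _); rewrite /= scaler0.
    by apply: contra rz0 => /eqP /(congr1 snd) /= ->.
  (* [r] brings [y] into the image of [i], but [r *: z] may lie outside that of [j]; a second
     multiplier [s] repairs this and keeps the second component nonzero. *)
  have [rz|/(essential_imageE je) [s [w [jw sz0]]]] := eqVneq (r *: z) 0.
    exists r, (x, 0); rewrite aE /= linear0 ix.
    split; first by congr (_, _); rewrite /= ?scalerA.
    by apply: contra ry0 => /eqP /(congr1 fst) /= ->.
  exists (s * r), (s *: x, w); rewrite aE /= linearZ ix jw.
  rewrite scalerA in sz0; split; first by congr (_, _); rewrite /= ?scalerA.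
  by apply: contra sz0 => /eqP /(congr1 snd) /= ->.
- by move=> k0; apply: proj_mod_prod; [apply: Ip | apply: Jp].
- exact: CDF.
Qed.

Lemma cosyz_step_iso k M N C : iso M N -> cosyz_step k N C -> cosyz_step k M C.
Proof.
case=> f fb [I [N' [i [p [[ii ps e] Ii ie Ip CN]]]]].
exists I, N', (i \o f : {linear M -> I}), p; split=> //.
  split=> //; first by apply: inj_comp => //; apply: bij_inj.
  move=> y; rewrite e; split=> [[x <-]|[x <-]]; last by exists (f x).
  by have [g fK gK] := fb; exists (g x); rewrite /= gK.
move=> S Sc /(ie S Sc) [x Sx x0]; have [g fK gK] := fb.
by exists (g x); rewrite /= gK.
Qed.

(** The predecessor is truncated, so at [k = 0] the invariant reproduces itself and the coresolution
    continues without demands on projectivity. Zero cosyzygies are dropped from the sum. *)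
Lemma dsum_cosyz_step (B : nat -> lmodType R -> Prop) k M :
  (forall X, B k X -> cosyz_step k X (fun Y => B k.-1 Y \/ zero_mod Y)) ->
  dsum (B k) M -> cosyz_step k M (dsum (B k.-1)).
Proof.
move=> Bs; elim=> {M} [M M0|M X Y BX _ IH MXY].
  by apply: cosyz_step_zero => // Z; apply: dsum_zero.
apply: cosyz_step_iso MXY _; apply: cosyz_step_prod (Bs _ BX) IH _ => X' Y' [BX'|X0] dY.
  by apply: dsum_cons BX' dY _; exists idfun; exists id.
apply: dsum_iso dY; exists (snd : {linear (X' * Y')%type -> Y'}).
exists (fun y => (0, y)) => // -[x y] /=.
by rewrite (X0 x).
Qed.

(** The content of [cosyz_step] as data, so that choice can drive a recursion on it. *)
Record cosyz_data k M (C : lmodType R -> Prop) := CosyzData {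
  cd_mod : lmodType R;
  cd_next : lmodType R;
  cd_emb : {linear M -> cd_mod};
  cd_proj : {linear cd_mod -> cd_next};
  cd_ses : ses cd_emb cd_proj;
  cd_inj : inj_mod cd_mod;
  cd_ess : essential_image cd_emb;
  cd_pinj : (0 < k)%N -> proj_mod cd_mod;
  cd_nextP : C cd_next
}.

Lemma cosyz_stepP k M C : cosyz_step k M C -> exists D : cosyz_data k M C, True.
Proof. by case=> I [M' [i [p [h1 h2 h3 h4 h5]]]]; exists (CosyzData h1 h2 h3 h4 h5). Qed.

(** Dependent choice along pairs of a counter and a module. Each differential is the projection onto
    a cosyzygy followed by the next embedding, so it inherits exactness and essentiality. *)
Lemma minimal_ir_exists (C : nat -> lmodType R -> Prop) :
  (forall k M, C k M -> cosyz_step k M (C k.-1)) ->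
  forall k M, C k M -> exists2 I : inj_resolution M, minimal_ir I &
    forall j, (j < k)%N -> proj_mod (I j).
Proof.
move=> Cs k M CkM.
pose state := {kM : nat * lmodType R | C kM.1 kM.2}.
pose D (s : state) : cosyz_data (sval s).1 (sval s).2 (C (sval s).1.-1) :=
  sval (cid (cosyz_stepP (Cs _ _ (svalP s)))).
pose next (s : state) : state :=
  exist _ ((sval s).1.-1, cd_next (D s)) (cd_nextP (D s)).
pose st j : state := iter j next (exist _ (k, M) CkM).
pose diff j : {linear cd_mod (D (st j)) -> cd_mod (D (st j.+1))} :=
  (cd_emb (D (st j.+1)) \o cd_proj (D (st j)) :
     {linear cd_mod (D (st j)) -> cd_mod (D (st j.+1))}).
have e0 j y : diff j y = 0 <-> cd_proj (D (st j)) y = 0.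
  have [ii _ _] := cd_ses (D (st j.+1)).
  split=> [dy|/= ->]; last exact: linear0.
  by apply: ii; rewrite linear0.
have im j z : (exists y, diff j y = z) <-> (exists y, cd_emb (D (st j.+1)) y = z).
  have [_ ps _] := cd_ses (D (st j)).
  split=> [[y <-]|[y <-]]; first by exists (cd_proj (D (st j)) y).
  by have [x <-] := ps y; exists x.
have hI j : inj_mod (cd_mod (D (st j))) by apply: cd_inj.
have ha : injective (cd_emb (D (st 0))) by have [] := cd_ses (D (st 0)).
have h0 : exact_at (cd_emb (D (st 0))) (diff 0).
  by move=> y; rewrite e0; have [_ _ ->] := cd_ses (D (st 0)).
have hS j : exact_at (diff j) (diff j.+1).
  by move=> y; rewrite e0 im; have [_ _ ->] := cd_ses (D (st j.+1)).
exists (InjResolution hI ha h0 hS).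
  split; first exact: (@cd_ess _ _ _ (D (st 0))).
  move=> j S Sc /(@cd_ess _ _ _ (D (st j.+1)) _ Sc) [x Sx x0].
  have [_ ps _] := cd_ses (D (st j)); have [y yE] := ps x.
  by exists y; rewrite /= yE.
move=> j jk /=; apply: cd_pinj; suff -> : (sval (st j)).1 = (k - j)%N by rewrite subn_gt0.
by elim: j {jk} => [|j IH] /=; rewrite ?subn0 // IH subnS.
Qed.

Lemma ir_tail M (I : inj_resolution M) :
  exists (C : lmodType R) (p : {linear I 0 -> C}) (J : inj_resolution C),
    [/\ surj p, exact_at (ir_aug I) p & forall j, J j = I j.+1].
Proof.
case: I => Im a d Ii ai e0 eS /=.
have [|C [i [ii iE]]] := @ex_submodule R (Im 1) (fun y => exists x, d 0 x = y).
  split=> [|c _ _ [x <-] [y <-]]; first by exists 0; rewrite linear0.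
  by exists (c *: x + y); rewrite linearP.
have [p pE] : exists p : {linear Im 0 -> C}, forall x, i (p x) = d 0 x.
  by apply: (linear_lift_inj ii) => x; apply/iE; exists x.
have h0 : exact_at i (d 1) by move=> y; rewrite eS iE.
exists C, p, (@InjResolution R C (fun j => Im j.+1) i (fun j => d j.+1)
  (fun j => Ii j.+1) ii h0 (fun j => eS j.+1)); split=> //.
- move=> z; have [x xE] := (iE (i z)).1 (ex_intro _ z erefl).
  by exists x; apply: ii; rewrite pE.
- move=> y; rewrite -e0 -pE; split=> [->|py]; first exact: linear0.
  by apply: ii; rewrite py linear0.
Qed.

(* [pi] stands for projective-injective. *)
Definition pi_retract M N : Prop :=
  exists E, [/\ proj_mod E, inj_mod E & retract M (N * E)%type].

Lemma pi_retract_refl M : pi_retract M M.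
Proof.
pose Z : lmodType R := 'rV[R]_0; have Z0 : zero_mod Z := @zero_mod_rV0 R.
exists Z; split; [exact: proj_mod_zero | exact: inj_mod_zero |].
have [h hE] := ex_null M Z; have [i iE] := ex_pair idfun h.
by exists i, fst => x; rewrite /= iE.
Qed.

(** The dual of Schanuel's lemma for retracts. The inclusion and the retraction extend to maps [a]
    and [b] between the injective modules and induce [al] and [be] on cokernels; the new
    projective-injective complement is [I] itself, which absorbs the failure of [b \o a] to be the
    identity. *)
Lemma pi_retract_cosyz M I (C : lmodType R) (m : {linear M -> I}) (p : {linear I -> C})
    M' I' (C' : lmodType R) (m' : {linear M' -> I'}) (p' : {linear I' -> C'}) :
  ses m p -> ses m' p' -> proj_mod I -> inj_mod I -> inj_mod I' ->
  fin_gen M -> fin_gen M' -> pi_retract M M' -> pi_retract C C'.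
Proof.
move=> [mi ps e] [mi' ps' e'] Ip Ii Ii' Mf Mf' [E [Ep Ei [i [r rK]]]].
have pm x : p (m x) = 0 by apply/e; exists x.
have pm' x : p' (m' x) = 0 by apply/e'; exists x.
have [m1 m1E] := ex_prod_map m' (idfun : {linear E -> E}).
have [IEf IEe] := inj_mod_prod Ii' Ei; have [If Ie] := Ii.
have m1i : injective m1 by move=> [x y] [x' y']; rewrite !m1E => -[/mi' -> ->].
have [a aE] := IEe _ _ m (m1 \o i : {linear M -> (I' * E)%type}) Mf If mi.
have [b bE] := Ie _ _ m1 (m \o r : {linear (M' * E)%type -> I})
  (fin_gen_prod Mf' Ei.1) IEf m1i.
have [in1 in1E] := ex_pair (idfun : {linear I' -> I'}) (sval (cid (ex_null I' E))).
have {}in1E x : in1 x = (x, 0) by rewrite in1E (svalP (cid (ex_null I' E))).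
have [al alE] : exists al : {linear C -> C'}, forall x, al (p x) = p' (a x).1.
  apply: (linear_factor (h := p' \o (fst \o a) : {linear I -> C'}) ps).
  by move=> x /e [y <-] /=; rewrite aE /= m1E /= pm'.
have [be beE] : exists be : {linear C' -> C}, forall x, be (p' x) = p (b (in1 x)).
  apply: (linear_factor (h := p \o (b \o in1) : {linear I' -> C}) ps').
  move=> x /e' [y <-] /=; rewrite in1E.
  have -> : (m' y, 0) = m1 (y, 0) by rewrite m1E.
  by rewrite bE /= pm.
(* [1 - b a] vanishes on the image of [m], hence factors through [C] as [psi]; then [be al + p psi]
   is the identity of [C]. *)
have [phi phiE] : exists phi : {linear I -> I}, forall x, phi x = x - b (a x).
  have [|k kE] := @mk_linear R I I (fun x => x - b (a x)); last by exists k.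
  by move=> c x y; rewrite [a _]linearP [b _]linearP scalerBr opprD addrACA.
have [psi psiE] : exists psi : {linear C -> I}, forall x, psi (p x) = phi x.
  apply: linear_factor ps _ => x /e [y <-].
  by rewrite phiE aE /= bE /= rK subrr.
exists I; split=> //.
have [u uE] := ex_pair al psi; have [v vE] := ex_copair be p.
exists u, v => c; have [x <-] := ps c.
rewrite vE uE /= psiE alE beE phiE linearB.
(* The component of [a x] in [E] may be discarded: it lies in the image of [m1], so [b] sends it
   into the image of [m], which [p] kills. *)
have -> : p (b (in1 (a x).1)) = p (b (a x)); last by rewrite addrC subrK.
have -> : in1 (a x).1 = a x - m1 (0, (a x).2).
  by rewrite in1E m1E linear0 /=; case: (a x) => z w; congr (_, _); rewrite /= ?subr0 ?subrr.
by rewrite !linearB bE /= pm subr0.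
Qed.

(** The embeddings are not asked to be essential, since the comparison below works modulo
    projective-injective summands. *)
Inductive pi_cosyz : nat -> lmodType R -> lmodType R -> Prop :=
| pi_cosyz0 M : pi_cosyz 0 M M
| pi_cosyzS d M I N (C : lmodType R) (i : {linear M -> I}) (p : {linear I -> N}) of
    ses i p & proj_mod I & inj_mod I & fin_gen M & pi_cosyz d N C :
    pi_cosyz d.+1 M C.

Lemma pi_cosyz_compare d M C : pi_cosyz d M C ->
  forall M' (J : inj_resolution M'), fin_gen M' -> pi_retract M M' ->
  exists (C' : lmodType R) (J' : inj_resolution C'),
    pi_retract C C' /\ forall j, J' j = J (d + j)%N.
Proof.
elim=> {d M C} [M|d M I N C i p ip Ip Ii Mf _ IH] M' J Mf' MM'; first by exists M', J.
have [N' [p' [J1 [ps' e' J1E]]]] := ir_tail J.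
have ip' : ses (ir_aug J) p' by split=> //; apply: ir_aug_inj.
have I'i := ir_inj J 0.
have [||C' [J' [CC' J'E]]] := IH N' J1.
- exact: fin_gen_surj ps' I'i.1.
- exact: pi_retract_cosyz ip ip' Ip Ii I'i Mf Mf' MM'.
by exists C', J'; split=> // j; rewrite J'E J1E.
Qed.

(** The cosyzygy [C'] read off from [J] has a resolution with zero term in degree 1, so it is
    isomorphic to the term in degree 0, and [C] is a retract of [C' * E]. *)
Lemma pi_cosyz_inj d M C n (J : inj_resolution M) : fin_gen M -> pi_cosyz d M C ->
  (n <= d)%N -> (forall j, (n < j)%N -> zero_mod (J j)) -> inj_mod C.
Proof.
move=> Mf MC nd J0.
have [C' [J' [[E [_ Ei CC']] J'E]]] := pi_cosyz_compare MC J Mf (pi_retract_refl M).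
apply: inj_mod_retract CC' _; apply: inj_mod_prod Ei.
have J10 : zero_mod (J' 1) by rewrite J'E; apply: J0; rewrite addn1 ltnS.
apply: inj_mod_retract (ir_inj J' 0); apply: iso_retract; exists (ir_aug J').
apply: inj_surj_bij; first exact: ir_aug_inj.
by move=> y; apply/ir_exact0; apply: J10.
Qed.

(** [C] embeds in [C' * E], and [C'] in [J d]. Excludes a projective term in degree [d]. *)
Lemma pi_cosyz_embed d M (C : lmodType R) (J : inj_resolution M) :
  fin_gen M -> pi_cosyz d M C -> proj_mod (J d) ->
  exists (P : lmodType R) (i : {linear C -> P}), proj_mod P /\ injective i.
Proof.
move=> Mf MC Jp.
have [C' [J' [[E [Ep _ [i [r rK]]]] J'E]]] := pi_cosyz_compare MC J Mf (pi_retract_refl M).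
have [h hE] := ex_prod_map (ir_aug J') (idfun : {linear E -> E}).
exists (J' 0 * E)%type, (h \o i : {linear C -> (J' 0 * E)%type}); split.
  by apply: proj_mod_prod => //; rewrite J'E addn0.
apply: inj_comp (can_inj rK) => -[x y] [x' y']; rewrite !hE => -[/ir_aug_inj /= -> ->] //.
Qed.

End InjectiveResolutions.

(** * Intervals and the functions f and g *)

Section Combinatorics.

(* With [f] and [g] as in the header, the syzygies of the interval [[s, t)] are the
   intervals between consecutive terms of [alt f s t] and its cosyzygies those
   between consecutive terms, in reverse order, of [alt g t s]. *)
Definition alt (h : int -> int) (s t : int) (j : nat) : int :=
  iter j./2 h (if odd j then t else s).

Lemma altSS h s t j : alt h s t j.+2 = h (alt h s t j).
Proof. by rewrite /alt /= negbK. Qed.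

Lemma altS h s t j : alt h s t j.+1 = alt h t (h s) j.
Proof.
rewrite /alt /= uphalf_half; case: (odd j) => //=.
by rewrite -iterSr.
Qed.

Lemma alt_iter h s t k j : alt h s t (j + k.*2)%N = iter k h (alt h s t j).
Proof. by elim: k => [|k IH]; rewrite ?addn0 // doubleS !addnS altSS IH. Qed.

Variables f g : int -> int.
Local Notation T a := (alt g (f a) a).

Lemma iter_f_alt_g a d : (forall i, (i < d)%N -> f (T a i.+2) = T a i) ->
  forall k i, (i + k.*2 < d.+2)%N -> iter k f (T a (i + k.*2)) = T a i.
Proof.
move=> Td; elim=> [|k IH] i; first by rewrite addn0.
rewrite doubleS !addnS => lt; rewrite iterSr Td; last by lia.
by apply: IH; lia.
Qed.

(** Both sides equal [f a]: [f^k] brings [T_(2k+1)] back to [a], while [f^(k+1)] brings [T_(2k+2)]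
    back to [T_0]. *)
Lemma odd_collapse a k : (forall i, (i < k.*2.+1)%N -> f (T a i.+2) = T a i) ->
  T a k.*2.+2 = g (T a k.*2.+1) ->
  iter k.+1 f (T a k.*2.+1) = iter k.+1 f (g (T a k.*2.+1)).
Proof.
move=> Td <-; have e0 := @iter_f_alt_g _ _ Td k.+1 0; have e1 := @iter_f_alt_g _ _ Td k 1.
by rewrite [RHS]e0 //= [iter k f _]e1 //; lia.
Qed.

Hypothesis f_mono : forall a b : int, a <= b -> f a <= f b.

Lemma iter_f_mono k (a b : int) : a <= b -> iter k f a <= iter k f b.
Proof. by move=> ab; elim: k => //= k; apply: f_mono. Qed.

Hypothesis f_gt : forall a : int, a < f a.

(** The cosyzygies are nonzero up to step [d]: an inequality [T_(j+2) <= T_(j+3)] would be carried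
    by [f] to [T_j <= T_(j+1)]. *)
Lemma alt_g_lt a d : g (f a) < a -> (forall i, (i < d)%N -> f (T a i.+2) = T a i) ->
  forall j, (j <= d)%N -> T a j.+1 < T a j.
Proof.
move=> gfa Td; suff H j : ((j <= d)%N -> T a j.+1 < T a j) /\
    ((j.+1 <= d)%N -> T a j.+2 < T a j.+1).
  by move=> j; have [] := H j.
elim: j => [|j [IH1 IH2]]; first by split=> _; [exact: f_gt | exact: gfa].
split=> // jd; case: (ltP (T a j.+3) (T a j.+2)) => // /f_mono.
rewrite Td; last by lia.
by rewrite Td; [have := IH1 ltac:(lia); lia | lia].
Qed.

Variable N : nat.
Hypothesis f_per : forall a : int, f (a + N%:Z) = f a + N%:Z.

Lemma f_perM (a m : int) : f (a + m * N%:Z) = f a + m * N%:Z.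
Proof.
have fP (n : nat) b : f (b + n%:Z * N%:Z) = f b + n%:Z * N%:Z.
  elim: n b => [|n IH] b; first by rewrite mul0r !addr0.
  have -> : b + n.+1%:Z * N%:Z = b + n%:Z * N%:Z + N%:Z by lia.
  by rewrite f_per IH; lia.
case: (leP 0 m) => m0; first by have := fP `|m|%N a; rewrite gez0_abs.
have := fP `|m|%N (a + m * N%:Z); rewrite lez0_abs; last by lia.
have -> : a + m * N%:Z + - m * N%:Z = a by lia.
lia.
Qed.

Lemma iter_f_perM k (a m : int) : iter k f (a + m * N%:Z) = iter k f a + m * N%:Z.
Proof. by elim: k => //= k ->; rewrite f_perM. Qed.

Hypothesis N_gt0 : (0 < N)%N.

(** Provides the value [g b], characterised as a lower adjoint of [f]; this equivalence is all that
    is used of [g] later. *)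
Lemma ex_adjoint (b : int) : exists x : int, forall a, (x <= a) = (b <= f a).
Proof.
(* Translating [b] down by more than [|f b - b|] periods pushes [f a0] below [b], so the search for
   the least element can start at [a0]. *)
pose k := `|f b - b|.+1; pose a0 := b - k%:Z * N%:Z.
have fb := f_gt b.
have fa0 : f a0 < b.
  have -> : a0 = b + (- k%:Z) * N%:Z by rewrite /a0; lia.
  rewrite f_perM /k; nia.
have ex : exists j : nat, b <= f (a0 + j%:Z).
  exists (k * N)%N; have -> : a0 + (k * N)%N%:Z = b by rewrite /a0; lia.
  lia.
case: (ex_minnP ex) => m bm mP; exists (a0 + m%:Z) => a; apply/idP/idP => [xa|ba].
  exact: le_trans bm (f_mono xa).
case: (leP a0 a) => aa0; last by have := f_mono (ltW aa0); lia.
have aE : a0 + `|a - a0|%N%:Z = a by lia.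
have /mP : b <= f (a0 + `|a - a0|%N%:Z) by rewrite aE.
lia.
Qed.

(** A gap of at least [N] never closes, since [f^k] sends [x + N] to [f^k(x) + N]. Up to translation
    this leaves finitely many pairs, and [B] is the maximum of their exponents, with 0 for pairs
    that are never identified. *)
Lemma iter_f_eq_bound : exists B, forall k x y,
  iter k f x = iter k f y -> iter B f x = iter B f y.
Proof.
pose E (i j : 'I_N) b := forall k,
  iter k f i%:Z = iter k f (i%:Z + j%:Z) -> iter b f i%:Z = iter b f (i%:Z + j%:Z).
have /choice [b bE] : forall ij : 'I_N * 'I_N, exists b, E ij.1 ij.2 b.
  move=> [i j]; have [[k kE]|nE] := pselect (exists k,
    iter k f i%:Z = iter k f (i%:Z + j%:Z)); first by exists k.
  by exists 0 => k kE; case: nE; exists k.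
pose B := \max_ij b ij; exists B => k x y.
wlog xy : x y / x <= y.
  by move=> H e; case: (leP x y) => [xy|/ltW yx]; [apply: H | apply/esym/H].
move=> e; have dlt : y - x < N%:Z.
  case: (ltP (y - x) N%:Z) => // le.
  have := @iter_f_mono k (x + 1 * N%:Z) y; rewrite iter_f_perM; lia.
have [i [j [q [xE yE]]]] : exists (i j : 'I_N) (q : int),
    x = i%:Z + q * N%:Z /\ y = i%:Z + j%:Z + q * N%:Z.
  have x0 : 0 <= (x %% N%:Z)%Z by rewrite modz_ge0 //; lia.
  have x1 : (x %% N%:Z)%Z < N%:Z by rewrite ltz_pmod //; lia.
  have iP : (`|(x %% N%:Z)%Z| < N)%N by rewrite -ltz_nat gez0_abs.
  have jP : (`|(y - x)%R| < N)%N by lia.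
  exists (Ordinal iP), (Ordinal jP), (x %/ N%:Z)%Z.
  have e1 : x = (`|(x %% N%:Z)%Z|)%N%:Z + (x %/ N%:Z)%Z * N%:Z.
    by rewrite gez0_abs // addrC -divz_eq.
  by split=> //=; rewrite addrAC -e1; lia.
have eij : iter k f i%:Z = iter k f (i%:Z + j%:Z).
  by move: e; rewrite xE yE !iter_f_perM; lia.
have bB : (b (i, j) <= B)%N by apply: (leq_bigmax (i, j)).
rewrite xE yE !iter_f_perM; congr (_ + _).
by rewrite -(subnK bB) !iterD (bE (i, j) k eij).
Qed.

Lemma coresolution_finite a : g (f a) < a -> exists j, f (T a j.+2) != T a j.
Proof.
move=> gfa; apply: contrapT => H; have {}H j : f (T a j.+2) = T a j.
  by apply/eqP/negP => h; apply: H; exists j; apply/negP.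
have Hd d i : (i < d)%N -> f (T a i.+2) = T a i by [].
have [B BP] := iter_f_eq_bound.
have e1 k i : iter k f (T a (i + k.*2)) = T a i.
  by apply: (iter_f_alt_g (Hd (i + k.*2)%N)); rewrite ltnS leqnSn.
(* [f^(B+1)] sends both to [T_0], because [f] takes the same value at [T_1 = a] and [T_2 = g (f a)].
   Hence [f^B] already identifies them, which reads [T_1 = T_2]. *)
have : iter B f (T a (1 + B.*2)) = iter B f (T a (2 + B.*2)).
  by apply: (BP B.+1); rewrite /= !e1 H.
rewrite !e1 => /eqP; rewrite eq_sym; move=> /eqP e; move: gfa.
by rewrite [g (f a)]e ltxx.
Qed.

Hypothesis gf : forall a b : int, (g b <= a) = (b <= f a).

(** In terms of modules: the injective hull [g(f(a)), f(a)) of an indecomposable projective is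
    projective. *)
Lemma fgf a : f (g (f a)) = f a.
Proof.
apply/eqP; rewrite eq_le -(gf (g (f a)) (f a)) lexx andbT; apply: f_mono.
by rewrite gf.
Qed.

(* After a shift by a multiple of [N], the first member of the chain beyond
   [g x] is followed by one below [x], so that [f^k] identifies the two. *)
Lemma chain_bound k x : iter k f x = iter k f (g x) ->
  exists B, forall s0 s1 : int, s0 <= s1 -> s1 <= f s0 ->
    exists2 J, (J <= B)%N & alt f s0 s1 J = alt f s0 s1 J.+1.
Proof.
(* Every two steps the chain gains at least 1, so [2N + 1] steps reach the translate [y'] of [g x]
   chosen below; another [2k] steps apply [f^k]. *)
move=> e; exists (N.*2.+1 + k.*2)%N => s0 s1 s01 s1f.
pose S := alt f s0 s1.
have S_inc j : S j <= S j.+1 /\ S j.+1 <= S j.+2.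
  elim: j => [|j [IH1 IH2]]; first by split; rewrite /S /alt.
  by split=> //; rewrite /S (altSS f s0 s1 j) altSS f_mono.
(* The shift with [s1 < y' <= s1 + N]. Lying beyond [s1] forces the first index [j] with [y' <= S j]
   to be at least 2. *)
pose m := ((s1 - g x) %/ N%:Z)%Z + 1.
pose y' := g x + m * N%:Z; pose x' := x + m * N%:Z.
have dE := divz_eq (s1 - g x) N%:Z.
have d0 : 0 <= ((s1 - g x) %% N%:Z)%Z by rewrite modz_ge0 //; lia.
have d1 : ((s1 - g x) %% N%:Z)%Z < N%:Z by rewrite ltz_pmod //; lia.
have y'1 : s1 < y' by rewrite /y' /m mulrDl; lia.
have y'2 : y' <= s1 + N%:Z by rewrite /y' /m mulrDl; lia.
have adj (b : int) : b < y' -> f b < x'.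
  have := gf (b + (- m) * N%:Z) x; rewrite f_perM /y' /x'.
  rewrite !mulNr; case: leP; case: leP; lia.
have e' : iter k f x' = iter k f y' by rewrite !iter_f_perM e.
have S_ge i : s1 + i%:Z <= S (1 + i.*2)%N.
  elim: i => [|i IH]; first by rewrite addr0.
  rewrite doubleS !addnS /S altSS; have := f_gt (S (1 + i.*2)%N); rewrite /S.
  by move: IH; rewrite /S; lia.
have ex : exists j, y' <= S j by exists (1 + N.*2)%N; apply: le_trans y'2 (S_ge N).
case: (ex_minnP ex) => j yj jP.
have jle : (j <= 1 + N.*2)%N by apply: jP; apply: le_trans y'2 (S_ge N).
case: j => [|[|i]] in yj jP jle *.
- by move: yj; rewrite /S /alt /=; lia.
- by move: yj; rewrite /S /alt /=; lia.
have lt : S i.+1 < y'.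
  by case: (ltP (S i.+1) y') => // /jP; rewrite ltnn.
have lt3 : S i.+3 < x' by rewrite /S altSS; apply: adj.
have [_ le23] := S_inc i.+1.
exists (i.+2 + k.*2)%N; first by lia.
rewrite -addSn !alt_iter -/(S i.+2) -/(S i.+3).
apply/eqP; rewrite eq_le iter_f_mono //=.
have := @iter_f_mono k _ _ (ltW lt3); have := @iter_f_mono k _ _ yj; rewrite e'.
by move=> h1 h2; apply: le_trans h2 h1.
Qed.

End Combinatorics.

(** * Modules over a finite-dimensional algebra *)

Section Complements.
Variables (K : fieldType) (V : lmodType K).

(** The projection has as its kernel the span of a maximal subfamily of the generators whose span
    meets [W] trivially. *)
Lemma ex_subspace_proj (T : finType) (s : T -> V) (W : V -> Prop) :
  (forall x, exists c : T -> K, x = \sum_i c i *: s i) -> submod W ->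
  exists p : {linear V -> V}, (forall x, W (p x)) /\ (forall x, W x -> p x = x).
Proof.
move=> sP [W0 WD].
have WZ c x : W x -> W (c *: x) by move=> Wx; rewrite -[_ *: _]addr0; apply: WD.
have WA x y : W x -> W y -> W (x + y) by rewrite -[x in W (x + y)]scale1r; apply: WD.
have WN x : W x -> W (- x) by rewrite -scaleN1r; apply: WZ.
(* Only the sum, not its coefficients, is required to vanish: the span over [J] meets [W] in 0,
   though the family itself may be dependent. *)
pose indep (J : {set T}) :=
  `[< forall c : T -> K, W (\sum_(j in J) c j *: s j) -> \sum_(j in J) c j *: s j = 0 >].
have [|J /maxsetP [/asboolP Ji Jmax] _] := @maxset_exists _ indep set0.
  by apply/asboolP => c; rewrite big_set0.
have dec x : exists w c, W w /\ x = w + \sum_(j in J) c j *: s j.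
  have sdec i : exists w c, W w /\ s i = w + \sum_(j in J) c j *: s j.
    have [iJ|iJ] := boolP (i \in J).
      exists 0, (fun j => (j == i)%:R); split=> //; rewrite add0r (bigD1 i) //= eqxx scale1r.
      by rewrite big1 ?addr0 // => j /andP [_ /negbTE ->]; rewrite scale0r.
    have nJ : ~ indep (i |: J).
      move=> /Jmax -/(_ (subsetUr _ _)) JE; move: iJ.
      by rewrite -JE setU11.
    have [c [Wc nc]] : exists c : T -> K, W (\sum_(j in i |: J) c j *: s j) /\
        \sum_(j in i |: J) c j *: s j <> 0.
      apply: contrapT => h; apply: nJ; apply/asboolP => c Wc.
      by apply: contrapT => nc; apply: h; exists c.
    move: Wc nc; rewrite big_setU1 //= => Wc nc.
    have [ci|ci] := eqVneq (c i) 0.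
      by move: Wc nc; rewrite ci scale0r add0r => /Ji.
    exists ((c i)^-1 *: (c i *: s i + \sum_(j in J) c j *: s j)).
    exists (fun j => - ((c i)^-1 * c j)).
    split; first exact: WZ.
    rewrite scalerDr scalerA mulVf // scale1r -addrA -[LHS]addr0; congr (_ + _).
    rewrite scaler_sumr -big_split /= big1 // => j _.
    by rewrite scalerA scaleNr subrr.
  have [c ->] := sP x; elim/big_ind: _ => [|y z [w [b [Ww ->]]] [w' [b' [Ww' ->]]]|i _].
  - by exists 0, (fun=> 0); split=> //; rewrite add0r big1 // => j _; rewrite scale0r.
  - exists (w + w'), (fun j => b j + b' j); split; first exact: WA.
    rewrite addrACA; congr (_ + _); rewrite -big_split /=.
    by apply: eq_bigr => j _; rewrite scalerDl.
  - have [w [b [Ww ->]]] := sdec i; exists (c i *: w), (fun j => c i * b j).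
    split; first exact: WZ.
    by rewrite scalerDr scaler_sumr; congr (_ + _); apply: eq_bigr => j _; rewrite scalerA.
(* The coefficients over [J] need not be unique, but the component in [W] is, and this makes the
   projection linear. *)
have uniq w c w' c' : W w -> W w' ->
    w + \sum_(j in J) c j *: s j = w' + \sum_(j in J) c' j *: s j -> w = w'.
  move=> Ww Ww' e; have eE : w' - w = \sum_(j in J) (c j - c' j) *: s j.
    under eq_bigr do rewrite scalerBl.
    rewrite sumrB -[\sum_(j in J) c j *: s j](addKr w) e [- w + _]addrC.
    by rewrite [_ - w - _]addrAC addrK.
  have : w' - w = 0 by rewrite eE Ji // -eE; apply: WA => //; apply: WN.
  by move/eqP; rewrite subr_eq0 => /eqP.
have [p pP] := choice dec; have [q qE] := choice pP.
have [|k kE] := @mk_linear K V V p.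
  move=> a x y; have [[Wx xE] [Wy yE]] := (qE x, qE y).
  have [Wxy xyE] := qE (a *: x + y).
  apply: (uniq _ (q (a *: x + y)) _ (fun j => a * q x j + q y j)) => //; first exact: WD.
  rewrite -xyE {1}xE {1}yE scalerDr addrACA; congr (_ + _).
  rewrite scaler_sumr -big_split /=; apply: eq_bigr => j _.
  by rewrite scalerDl scalerA.
exists k; split=> x; rewrite kE; first by have [] := qE x.
move=> Wx; have [Wp xE] := qE x.
apply: (uniq _ (q x) _ (fun=> 0)) => //; rewrite -xE big1 ?addr0 // => j _.
by rewrite scale0r.
Qed.

Lemma ex_separating (T : finType) (s : T -> V) (W : V -> Prop) v :
  (forall x, exists c : T -> K, x = \sum_i c i *: s i) -> submod W -> ~ W v ->
  exists phi : {linear V -> K^o}, (forall x, W x -> phi x = 0) /\ phi v = 1.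
Proof.
move=> sP Ws Wv; have [p [pW pid]] := ex_subspace_proj sP Ws.
have v'0 : v - p v != 0.
  by apply/negP => /eqP e; apply: Wv; rewrite -(subrK (p v) v) e add0r.
have [|r [rl rid]] := @ex_subspace_proj T s (fun x => exists c, x = c *: (v - p v)) sP.
  split=> [|c _ _ [a ->] [b ->]]; first by exists 0; rewrite scale0r.
  by exists (c * a + b); rewrite scalerDl scalerA.
have [c cE] := choice rl.
have c_inj a b : a *: (v - p v) = b *: (v - p v) -> a = b.
  by move/eqP; rewrite -subr_eq0 -scalerBl scaler_eq0 (negbTE v'0) orbF subr_eq0 => /eqP.
have [|phi phiE] := @mk_linear K V K^o (fun x => c (x - p x)).
  move=> a x y; apply: c_inj; rewrite -cE [(_ + _) *: _]scalerDl -scalerA -!cE -linearP.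
  by congr (r _); rewrite [p _]linearP scalerBr opprD addrACA.
exists phi; split=> [x Wx|]; rewrite phiE; apply: c_inj; rewrite -cE.
  by rewrite pid // subrr linear0 scale0r.
by rewrite scale1r rid //; exists 1; rewrite scale1r.
Qed.

End Complements.

Section RightModules.
Variables (K : fieldType) (L : falgType K).

Definition ract (M : rmodType L) (x : M) (y : L) : M := (y : L^c) *: x.
Local Notation "x |* y" := (ract x y) (at level 40, left associativity).

(** A separate name for the carrier, so that its K-space structure does not compete with the given
    action of [L^c]. *)
Definition over_field (M : rmodType L) : Type := M.
HB.instance Definition _ (M : rmodType L) := GRing.Zmodule.on (over_field M).

Section Action.
Variable M : rmodType L.
Implicit Types (x : M) (y z : L) (c : K).

Lemma ractA x y z : x |* y |* z = x |* (y * z).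
Proof. exact: scalerA. Qed.
Lemma ract1 x : x |* 1 = x.
Proof. exact: scale1r. Qed.
Lemma ractDl x x' y : (x + x') |* y = x |* y + x' |* y.
Proof. exact: scalerDr. Qed.
Lemma ractDr x y z : x |* (y + z) = x |* y + x |* z.
Proof. exact: scalerDl. Qed.
Lemma ract0 y : (0 : M) |* y = 0.
Proof. exact: scaler0. Qed.
Lemma ract0r x : x |* 0 = 0.
Proof. exact: scale0r. Qed.

Definition kscale c (x : over_field M) : over_field M := (x : M) |* c%:A.

Lemma kscaleA a b x : kscale a (kscale b x) = kscale (a * b) x.
Proof. by rewrite /kscale ractA -scalerAl mul1r scalerA mulrC. Qed.
Lemma kscale1 : left_id 1 kscale.
Proof. by move=> x; rewrite /kscale scale1r ract1. Qed.
Lemma kscaleDr : right_distributive kscale +%R.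
Proof. by move=> c x x'; apply: ractDl. Qed.
Lemma kscaleDl x : {morph kscale^~ x : a b / a + b}.
Proof. by move=> a b; rewrite /kscale scalerDl ractDr. Qed.

HB.instance Definition _ := GRing.Zmodule_isLmodule.Build K (over_field M)
  kscaleA kscale1 kscaleDr kscaleDl.
End Action.

Local Notation "[ M ]_K" := (over_field M : lmodType K) (at level 0, format "[ M ]_K").

Definition ksc (M : rmodType L) (c : K) (x : M) : M := (c *: (x : over_field M)).
Local Notation "c %* x" := (ksc c x) (at level 40).

Section KAction.
Variable M : rmodType L.
Implicit Types (x : M) (y z : L) (c : K).

Lemma ract_sumr I (r : seq I) (P : pred I) (F : I -> L) x :
  x |* (\sum_(i <- r | P i) F i) = \sum_(i <- r | P i) x |* F i.
Proof. exact: scaler_suml. Qed.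
Lemma ract_suml I (r : seq I) (P : pred I) (F : I -> M) y :
  (\sum_(i <- r | P i) F i) |* y = \sum_(i <- r | P i) F i |* y.
Proof. exact: scaler_sumr. Qed.
Lemma kscE c x : c %* x = x |* c%:A.
Proof. by []. Qed.
Lemma ksc_ract c x y : (c %* x) |* y = c %* (x |* y).
Proof. by rewrite !kscE !ractA -scalerAl mul1r -scalerAr mulr1. Qed.
Lemma ract_scale c x y : x |* (c *: y) = c %* (x |* y).
Proof. by rewrite !kscE ractA -scalerAr mulr1. Qed.
Lemma kscA a b x : a %* (b %* x) = (a * b) %* x.
Proof. exact: (scalerA a b (x : [M]_K)). Qed.
Lemma ksc1 x : 1 %* x = x.
Proof. exact: (scale1r (x : [M]_K)). Qed.
Lemma ksc0 x : 0 %* x = 0.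
Proof. exact: (scale0r (x : [M]_K)). Qed.
Lemma ksc0r c : c %* (0 : M) = 0.
Proof. exact: (scaler0 [M]_K c). Qed.
Lemma kscDl a b x : (a + b) %* x = a %* x + b %* x.
Proof. exact: (scalerDl (x : [M]_K)). Qed.
Lemma kscDr c x x' : c %* (x + x') = c %* x + c %* x'.
Proof. exact: (@scalerDr K [M]_K). Qed.
Lemma ksc_sumr I (r : seq I) (P : pred I) (F : I -> M) c :
  c %* (\sum_(i <- r | P i) F i) = \sum_(i <- r | P i) c %* F i.
Proof. exact: (@scaler_sumr K [M]_K). Qed.
Lemma ksc_eq0 c x : (c %* x == 0) = (c == 0) || (x == 0).
Proof. exact: (@scaler_eq0 K [M]_K). Qed.

Variable M' : rmodType L.
Implicit Types h : {linear M -> M'}.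
Lemma linear_ract h x y : h (x |* y) = h x |* y.
Proof. exact: linearZ. Qed.
Lemma linear_ksc h c x : h (c %* x) = c %* h x.
Proof. exact: linear_ract. Qed.

Lemma linear_of_ract (h : M -> M') :
  (forall x x', h (x + x') = h x + h x') -> (forall x y, h (x |* y) = h x |* y) ->
  {k : {linear M -> M'} | forall x, k x = h x}.
Proof. by move=> hD hM; apply: mk_linear => c x y; rewrite hD; congr (_ + _); apply: hM. Qed.

Lemma ex_linear_over_field h :
  exists k : {linear [M]_K -> [M']_K}, forall x, k x = h x.
Proof.
have [|k kE] := @mk_linear K [M]_K [M']_K h; last by exists k.
move=> c x y; rewrite -[_ *: _ + y]/((c %* (x : M)) + (y : M)) linearD.
by congr (_ + _); apply: linear_ksc.
Qed.
End KAction.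

(** An upper bound for the K-dimension, used as an induction measure without bases. *)
Definition kspan d (M : rmodType L) : Prop :=
  exists s : 'I_d -> M, forall x, exists c : 'I_d -> K, x = \sum_i c i %* s i.

Lemma fin_gen_kspan (M : rmodType L) : fin_gen M -> exists d, kspan d M.
Proof.
move=> [g gP]; pose T := ('I_(size g) * 'I_(\dim {:L}))%type.
pose b := vbasis {:L}.
exists #|{: T}|, (fun k : 'I_#|{: T}| => g`_(enum_val k).1 |* b`_(enum_val k).2) => x.
have [c ->] := gP x.
exists (fun k : 'I_#|{: T}| => coord b (enum_val k).2 (c (enum_val k).1)).
have -> : \sum_i c i *: g`_i = \sum_i \sum_j coord b j (c i) %* (g`_i |* b`_j).
  apply: eq_bigr => i _; rewrite -[_ *: _]/(g`_i |* c i).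
  rewrite [c i in LHS](coord_vbasis (memvf (c i))) ract_sumr.
  by apply: eq_bigr => j _; rewrite ract_scale.
rewrite pair_bigA /= (reindex (fun k : 'I_#|{: T}| => enum_val k)) //=.
exact/onW_bij/enum_val_bij.
Qed.

Lemma kspan_surj d (M M' : rmodType L) (h : {linear M -> M'}) :
  surj h -> kspan d M -> kspan d M'.
Proof.
move=> hs [s sP]; exists (fun i => h (s i)) => y; have [x <-] := hs y; have [c ->] := sP x.
by exists c; rewrite linear_sum; apply: eq_bigr => i _; rewrite linear_ksc.
Qed.

(** Gaussian elimination: a generator on which [phi] is nonzero serves as pivot, and subtracting its
    multiples moves the others into the kernel. *)
Lemma kspan_ker d (M Q M' : rmodType L) (i : {linear Q -> M}) (p : {linear M -> M'})
    (phi : {linear [M]_K -> K^o}) v : ses i p -> (forall x, p x = 0 <-> phi x = 0) ->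
  phi v != 0 -> kspan d M -> (0 < d)%N /\ kspan d.-1 Q.
Proof.
move=> [ii _ e] pphi phiv [s sP].
have [j0 sj0] : exists j0, phi (s j0) != 0.
  apply: contrapT => h; move: phiv; have [c ->] := sP v.
  rewrite (linear_sum phi) big1 ?eqxx // => j _; rewrite [phi _]linearZ.
  have -> : phi (s j) = 0 by apply/eqP/negPn/negP => hj; apply: h; exists j.
  by rewrite /= scaler0.
case: d s sP j0 sj0 => [|d] s sP j0 sj0; first by case: j0 sj0.
split=> //=; pose a j := phi (s j) / phi (s j0).
pose t j : M := s j + (- a j) %* s j0.
have phit j : phi (t j) = 0.
  rewrite /t addrC; have -> := linearP phi (- a j) (s j0) (s j).
  by rewrite -[_ *: _]/(_ * _) /a mulNr mulfVK // addNr.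
have /choice [r rE] : forall j, exists z, i z = t j by move=> j; apply/e/pphi.
exists (fun k => r (lift j0 k)) => x; have [c cE] := sP (i x).
exists (fun k => c (lift j0 k)); apply: ii; rewrite linear_sum.
have phi0 : \sum_j c j * phi (s j) = 0.
  have : phi (i x) = 0 by apply/pphi/e; exists x.
  rewrite cE (linear_sum phi) => h; rewrite -[RHS]h.
  by apply: eq_bigr => j _; rewrite [phi (_ %* _)]linearZ.
have -> : i x = \sum_j c j %* t j.
  rewrite [LHS]cE /t; apply/esym.
  under eq_bigr => j _ do rewrite kscDr kscA.
  rewrite big_split /= -[RHS]addr0; congr (_ + _).
  rewrite -[LHS]/(\sum_j (c j * - a j) *: (s j0 : [M]_K)) -scaler_suml.
  suff -> : \sum_j c j * - a j = 0 by rewrite scale0r.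
  rewrite /a; under eq_bigr => j _ do rewrite mulrN mulrA.
  by rewrite sumrN -mulr_suml phi0 mul0r oppr0.
rewrite (bigD1_ord j0) //= {1}/t /a divff // [-1 %* _](scaleN1r (s j0 : [M]_K)).
rewrite subrr ksc0r add0r.
by apply: eq_bigr => k _; rewrite linear_ksc rE.
Qed.

Lemma ex_functional_ext (M M' : rmodType L) (g : {linear M -> M'})
    (phi : {linear [M]_K -> K^o}) :
  fin_gen M' -> injective g ->
  exists psi : {linear [M']_K -> K^o}, forall x, psi (g x) = phi x.
Proof.
move=> /fin_gen_kspan [d [s sP]] gi; have [gk gkE] := ex_linear_over_field g.
have [|p [pW pid]] := @ex_subspace_proj K [M']_K _ s (fun y => exists x, y = gk x) sP.
  split=> [|c _ _ [x ->] [y ->]]; first by exists 0; rewrite linear0.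
  by exists (c *: x + y); rewrite linearP.
have [q qE] := choice pW.
have gki : injective gk by move=> x y; rewrite !gkE => /gi.
have [|k kE] := @mk_linear K [M']_K [M]_K q.
  by move=> c x y; apply: gki; rewrite -qE !linearP -!qE.
exists (phi \o k : {linear [M']_K -> K^o}) => x /=; congr (phi _); apply: gki.
by rewrite kE -qE pid; [exact: esym (gkE x) | exists x; exact: esym (gkE x)].
Qed.

Lemma ex_functional_sep (M : rmodType L) (W : [M]_K -> Prop) (v : M) :
  fin_gen M -> submod W -> ~ W v ->
  exists phi : {linear [M]_K -> K^o}, (forall x, W x -> phi x = 0) /\ phi v = 1.
Proof.
by move=> /fin_gen_kspan [d [s sP]] Ws Wv; apply: (@ex_separating K [M]_K _ s).
Qed.

End RightModules.

Local Notation "x |* y" := (ract x y) (at level 40, left associativity).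
Local Notation "[ M ]_K" := (over_field M) (at level 0, format "[ M ]_K").
Local Notation "c %* x" := (ksc c x) (at level 40).

(** * Uniserial modules *)

Section Nakayama.
Variables (K : fieldType) (L : falgType K) (N m : nat) (e : int -> L) (X : L).
Hypothesis N_gt0 : (0 < N)%N.
Hypothesis e_mod : forall a b : int, (a = b %[mod N%:Z])%Z -> e a = e b.
Hypothesis eM : forall a b : int,
  e a * e b = if (a == b %[mod N%:Z])%Z then e a else 0.
Hypothesis e_sum : \sum_(i < N) e i%:Z = 1.
Hypothesis e_neq0 : forall a, e a != 0.
Hypothesis eX : forall a, e a * X = X * e (a + 1).
Hypothesis X_nil : X ^+ m = 0.
(** The elements [e a * X ^+ k] span [L]; in the form of an induction principle this can be taken
    over from [pa_ind] on the path algebra. *)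
Hypothesis L_ind : forall P : L -> Prop, P 0 -> (forall x y, P x -> P y -> P (x + y)) ->
  (forall c x, P x -> P (c *: x)) -> (forall a k, P (e a * X ^+ k)) -> forall y, P y.
Implicit Types (a b : int) (k l : nat) (M P Q : rmodType L).

Lemma eMid a : e a * e a = e a.
Proof. by rewrite eM eqxx. Qed.

Lemma eXn a k : e a * X ^+ k = X ^+ k * e (a + k%:Z).
Proof.
elim: k => [|k IH]; first by rewrite addr0 mulr1 mul1r.
by rewrite exprSr mulrA IH -mulrA eX mulrA; congr (_ * e _); lia.
Qed.

Lemma Xn0 k : (m <= k)%N -> X ^+ k = 0.
Proof. by move=> /subnK <-; rewrite exprD X_nil mulr0. Qed.

Lemma ex_len a : exists l, e a * X ^+ l == 0.
Proof. by exists m; rewrite X_nil mulr0. Qed.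

(** The Kupisch series: the length of the uniserial module [e_a L]. *)
Definition len a : nat := ex_minn (ex_len a).

Lemma len_eq0 a l : (e a * X ^+ l == 0) = (len a <= l)%N.
Proof.
rewrite /len; case: ex_minnP => k k0 kmin; apply/idP/idP => [/kmin //|/subnK <-].
by rewrite addnC exprD mulrA (eqP k0) mul0r.
Qed.

Lemma len_gt0 a : (0 < len a)%N.
Proof. by rewrite lt0n -leqn0 -len_eq0 expr0 mulr1 e_neq0. Qed.

(** The Kupisch inequality, from [e_a X = X e_(a+1)]. It is what makes [lend] monotone. *)
Lemma len_succ a : (len a <= (len (a + 1)%R).+1)%N.
Proof.
rewrite -len_eq0 exprS mulrA eX -mulrA.
have /eqP -> : e (a + 1) * X ^+ len (a + 1) == 0 by rewrite len_eq0.
by rewrite mulr0.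
Qed.

Lemma len_mod a b : (a = b %[mod N%:Z])%Z -> len a = len b.
Proof. by move=> /e_mod ab; apply: eq_ex_minn => k; rewrite ab. Qed.

(* The right end of the interval representing the projective module [e_a L]. *)
Definition lend a : int := a + (len a)%:Z.

Lemma lend_mono a b : a <= b -> lend a <= lend b.
Proof.
have H k : lend a <= lend (a + k%:Z).
  elim: k => [|k IH]; first by rewrite addr0.
  apply: le_trans IH _; have := len_succ (a + k%:Z).
  have -> : a + k.+1%:Z = a + k%:Z + 1 by lia.
  rewrite /lend; lia.
move=> ab; have := H `|b - a|%N; suff -> : a + `|(b - a)%R|%N%:Z = b by [].
lia.
Qed.

Lemma lend_gt a : a < lend a.
Proof. by have := len_gt0 a; rewrite /lend; lia. Qed.

Lemma lend_per a : lend (a + N%:Z) = lend a + N%:Z.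
Proof.
rewrite /lend (@len_mod (a + N%:Z) a); first lia.
by rewrite modzDr.
Qed.

Lemma e_spanP a y : exists c : nat -> K, e a * y = \sum_(k < m) c k *: (e a * X ^+ k).
Proof.
elim/L_ind: y => [|x y [c cE] [d dE]|b x [c cE]|b k].
- by exists (fun=> 0); rewrite mulr0 big1 // => k _; rewrite scale0r.
- exists (fun k => c k + d k); rewrite mulrDr cE dE -big_split /=.
  by apply: eq_bigr => k _; rewrite scalerDl.
- exists (fun k => b * c k); rewrite -scalerAr cE scaler_sumr.
  by apply: eq_bigr => k _; rewrite scalerA.
rewrite mulrA eM; case: ifP => _; last first.
  by exists (fun=> 0); rewrite mul0r big1 // => j _; rewrite scale0r.
exists (fun j => (j == k)%:R); case: (ltnP k m) => km.
  rewrite (bigD1 (Ordinal km)) //= eqxx scale1r big1 ?addr0 // => j jk.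
  rewrite (_ : (j : nat) == k = false) ?scale0r //.
  by apply: contraNF jk => /eqP jk; apply/eqP/val_inj.
rewrite (Xn0 km) mulr0 big1 // => j _.
by rewrite (_ : (j : nat) == k = false) ?scale0r //; have := ltn_ord j; lia.
Qed.

Lemma linear_of_eX M Q (h : M -> Q) :
  (forall x x', h (x + x') = h x + h x') -> (forall c x, h (c %* x) = c %* h x) ->
  (forall a x, h (x |* e a) = h x |* e a) -> (forall x, h (x |* X) = h x |* X) ->
  exists h' : {linear M -> Q}, forall x, h' x = h x.
Proof.
move=> hD hZ he hX; have h0 : h 0 = 0 by rewrite -(ksc0 (0 : M)) hZ ksc0.
have [|k kE] := @linear_of_ract K L M Q h hD; last by exists k.
move=> x y; elim/L_ind: y => [|y z IHy IHz|c y IHy|a k].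
- by rewrite !ract0r.
- by rewrite !ractDr hD IHy IHz.
- by rewrite !ract_scale hZ IHy.
rewrite -!ractA -he; elim: k => [|k IH]; first by rewrite !expr0 !ract1.
by rewrite exprSr -!ractA hX IH.
Qed.

(* A K-basis of [M] is [u, uX, ..., uX^(l-1)]. *)
Definition uniserial a l M (u : M) : Prop :=
  [/\ u |* e a = u, u |* X ^+ l = 0, forall k, (k < l)%N -> u |* X ^+ k != 0
    & forall z, exists y, z = u |* y].

Definition xsum n M (u : M) (c : nat -> K) : M := \sum_(k < n) c k %* (u |* X ^+ k).

Lemma ract_X0 M (u : M) l k : u |* X ^+ l = 0 -> (l <= k)%N -> u |* X ^+ k = 0.
Proof. by move=> ul /subnK <-; rewrite addnC exprD -ractA ul ract0. Qed.

(** This power of [X] pushes every term above the lowest one past the end of the module. *)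
Lemma xsum_lead n M (u : M) c l k0 : u |* X ^+ l.+1 = 0 -> (k0 <= l)%N -> (k0 < n)%N ->
  (forall k, (k < k0)%N -> c k = 0) ->
  xsum n u c |* X ^+ (l - k0) = c k0 %* (u |* X ^+ l).
Proof.
move=> ul k0l k0n c0; rewrite /xsum ract_suml (bigD1 (Ordinal k0n)) //=.
rewrite ksc_ract ractA -exprD subnKC //.
rewrite big1 ?addr0 // => -[k kn] /= kk; rewrite ksc_ract ractA -exprD.
have [lt|gt|eq] := ltngtP k k0; first by rewrite c0 ?ksc0.
  by rewrite (ract_X0 ul) ?ksc0r //; lia.
by case/eqP: kk; apply: val_inj.
Qed.

(** The coefficients depend on [a] and [y] only, so the same [c] serves in every module; hence maps
    out of a uniserial module are well defined. *)
Lemma ract_xsum M (u : M) a y : u |* e a = u ->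
  exists c, (u |* y = xsum m u c) /\
    forall Q (v : Q), v |* e a = v -> v |* y = xsum m v c.
Proof.
have [c cE] := e_spanP a y; move=> ua; exists c.
have H Q (v : Q) : v |* e a = v -> v |* y = xsum m v c.
  move=> va; rewrite -va ractA cE ract_sumr /xsum; apply: eq_bigr => k _.
  by rewrite ract_scale -ractA !va.
by split; [exact: H | exact: H].
Qed.

Lemma xsum_indep n M (u : M) c l : u |* X ^+ l = 0 ->
  (forall k, (k < l)%N -> u |* X ^+ k != 0) -> xsum n u c = 0 ->
  forall k, (k < l)%N -> (k < n)%N -> c k = 0.
Proof.
move=> ul un s0 k; elim/ltn_ind: k => k IH kl kn.
case: l => [|l] // in ul un kl IH *.
have := @xsum_lead n M u c l k ul kl kn; rewrite s0 ract0 => H.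
have /esym/eqP : 0 = c k %* (u |* X ^+ l).
  by apply: H => j jk; apply: IH => //; lia.
by rewrite ksc_eq0 (negbTE (un l _)) // orbF => /eqP.
Qed.

Section Uniserial.
Variables (a : int) (l : nat) (M : rmodType L) (u : M).
Hypothesis uM : uniserial a l u.
Implicit Types z : M.

Lemma uniserial_le_len : (l <= len a)%N.
Proof.
case: uM => ue _ un _; rewrite leqNgt; apply/negP => /un.
have /eqP e0 : e a * X ^+ len a == 0 by rewrite len_eq0.
by rewrite -ue ractA e0 ract0r eqxx.
Qed.

Lemma uniserial_xsum z : exists c, z = xsum l u c.
Proof.
have [ue ul un ug] := uM; have [y ->] := ug z; have [c [-> _]] := ract_xsum y ue.
exists c; have lm : (l <= m)%N.
  rewrite leqNgt; apply/negP => /un; by rewrite X_nil ract0r eqxx.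
rewrite /xsum [RHS](big_ord_widen _ (fun k => c k %* (u |* X ^+ k)) lm).
rewrite [LHS](bigID (fun k : 'I_m => (k < l)%N)) /=.
rewrite [X in _ + X]big1 ?addr0 // => k; rewrite -leqNgt => lk.
by rewrite (ract_X0 ul lk) ksc0r.
Qed.

Lemma uniserial_ractX0 z : z |* X ^+ l = 0.
Proof.
have [ue ul un ug] := uM; have [c ->] := uniserial_xsum z.
rewrite /xsum ract_suml big1 // => k _.
by rewrite ksc_ract ractA -exprD addnC exprD -ractA ul ract0 ksc0r.
Qed.

(** Multiplying by the power of [X] that isolates the lowest nonzero coefficient of [z] leaves a
    nonzero multiple of the socle generator. Injectivity, essentiality and indecomposability are all
    tested on that element. *)
Lemma uniserial_socle z : z != 0 -> (0 < l)%N /\ exists y, z |* y = u |* X ^+ l.-1.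
Proof.
have [c zE] := uniserial_xsum z => z0; have [ue ul un ug] := uM.
have ex : exists k, (k < l)%N && (c k != 0).
  apply: contrapT => h; case/eqP: z0; rewrite zE /xsum big1 // => k _.
  have -> : c k = 0 by apply/eqP/negPn/negP => ck; apply: h; exists k; rewrite ltn_ord.
  by rewrite ksc0.
case: (ex_minnP ex) => k0 /andP [k0l ck0] kmin.
case: l ul un k0l kmin zE => // l' ul un k0l kmin zE; split=> //.
exists ((c k0)^-1 *: X ^+ (l' - k0)); rewrite ract_scale zE (xsum_lead ul) //.
  by rewrite kscA mulVf // ksc1.
move=> k kk0; apply/eqP/negPn/negP => ck.
have : (k0 <= k)%N by apply: kmin; rewrite ck andbT; lia.
by rewrite leqNgt kk0.
Qed.

Lemma uniserial_socle_scalar z : z |* X = 0 -> exists c, z = c %* (u |* X ^+ l.-1).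
Proof.
have [c zE] := uniserial_xsum z => zX; have [ue ul un ug] := uM.
exists (c l.-1); rewrite zE /xsum; case: l ul un zE => [|l'] ul un zE.
  by rewrite big_ord0 (ract_X0 ul) ?ksc0r.
have c0 k : (k < l')%N -> c k = 0.
  elim/ltn_ind: k => k IH kl.
  have kP : (k < l'.+1)%N by lia.
  have := @xsum_lead _ _ _ c _ _ ul (ltnW kl) kP.
  rewrite -zE -(prednK (n := (l' - k)%N)) ?subn_gt0 // exprS -ractA zX ract0 => H.
  have /esym/eqP : 0 = c k %* (u |* X ^+ l') by apply: H => j jk; apply: IH => //; lia.
  by rewrite ksc_eq0 (negbTE (un l' _)) // orbF => /eqP.
by rewrite big_ord_recr /= big1 ?add0r // => k _; rewrite c0 // ksc0.
Qed.

(** The universal property of [e_a L / e_a X^l L]. *)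
Lemma uniserial_map Q (v : Q) : v |* e a = v -> v |* X ^+ l = 0 ->
  exists h : {linear M -> Q}, h u = v.
Proof.
move=> va vl; have [ue ul un ug] := uM.
pose R : rmodType L := L^c^o.
have [p pE] : exists p : {linear R -> M}, forall y, p y = u |* y.
  have [|k kE] := @mk_linear _ R M (fun y => u |* y); last by exists k.
  by move=> c x y; rewrite ractDr; congr (_ + _); rewrite -[RHS]/(u |* x |* c) ractA.
have [q qE] : exists q : {linear R -> Q}, forall y, q y = v |* y.
  have [|k kE] := @mk_linear _ R Q (fun y => v |* y); last by exists k.
  by move=> c x y; rewrite ractDr; congr (_ + _); rewrite -[RHS]/(v |* x |* c) ractA.
have [|y|h hE] := @linear_factor _ R Q M p q.
- by move=> z; have [y ->] := ug z; exists y.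
- rewrite pE qE; have [c [-> cv]] := ract_xsum y ue; rewrite (cv _ _ va) => s0.
  rewrite /xsum big1 // => k _; case: (ltnP k l) => kl; last by rewrite (ract_X0 vl kl) ksc0r.
  by rewrite (xsum_indep ul un s0 kl (ltn_ord k)) ksc0.
by exists h; rewrite -(ract1 u) -pE hE qE ract1.
Qed.

Lemma uniserial_fin_gen : fin_gen M.
Proof.
have [_ _ _ ug] := uM; exists [:: u] => z; have [y ->] := ug z.
by exists (fun=> y); rewrite big_ord1.
Qed.

Lemma uniserial_map_inj Q (h : {linear M -> Q}) :
  h (u |* X ^+ l.-1) != 0 -> injective h.
Proof.
move=> h0; apply/injective0 => z hz; apply/eqP/negPn/negP => /uniserial_socle [_ [y yE]].
by move: h0; rewrite -yE linear_ract hz ract0 eqxx.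
Qed.

Lemma uniserial_surj Q (h : {linear Q -> M}) x : h x = u -> surj h.
Proof.
have [_ _ _ ug] := uM => hx z; have [y ->] := ug z; exists (x |* y).
by rewrite linear_ract hx.
Qed.

Lemma uniserial_zero : (l == 0)%N -> zero_mod M.
Proof. by move=> /eqP l0 z; have [c ->] := uniserial_xsum z; rewrite l0 /xsum big_ord0. Qed.

Lemma uniserial_neq0 : (0 < l)%N -> u |* X ^+ l.-1 != 0.
Proof. by have [_ _ un _] := uM => l0; apply: un; rewrite prednK. Qed.

Lemma uniserial_essential Q (f : {linear Q -> M}) :
  injective f -> ~ zero_mod Q -> essential_image f.
Proof.
move=> fi Q0; have [x x0] : exists x : Q, x != 0.
  by apply: contrapT => h; apply: Q0 => x; apply/eqP/negPn/negP => x0; apply: h; exists x.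
have fx0 : f x != 0 by apply: contra x0 => /eqP fx; apply/eqP/fi; rewrite fx linear0.
have [l0 [y yE]] := uniserial_socle fx0.
apply: essential_imageI => z /uniserial_socle [_ [y' y'E]].
exists (y' : L^c), (x |* y); rewrite linear_ract yE -y'E; split=> //.
rewrite -[_ *: _]/(z |* y') y'E; exact: uniserial_neq0.
Qed.

(** Two nonzero summands would both contain the socle generator. *)
Lemma uniserial_indecomposable : (0 < l)%N -> indecomposable M.
Proof.
move=> l0; split=> [M0|Y Z f fb].
  by have := uniserial_neq0 l0; rewrite (M0 (u |* _)) eqxx.
apply: contrapT => /not_orP [Y0 Z0].
have [g [fK gK]] := bij_linear_inv fb.
have nz (V : rmodType L) : ~ zero_mod V -> exists x : V, x != 0.
  move=> V0; apply: contrapT => h; apply: V0 => x; apply/eqP/negPn/negP => x0.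
  by apply: h; exists x.
have [[y y0] [z z0]] := (nz _ Y0, nz _ Z0).
have gn v : v != 0 -> g v != 0.
  by apply: contra => /eqP gv; apply/eqP; rewrite -[v]gK gv linear0.
have /uniserial_socle [_ [r rE]] : g (y, 0) != 0.
  by apply: gn; apply: contra y0 => /eqP [->].
have /uniserial_socle [_ [s sE]] : g (0, z) != 0.
  by apply: gn; apply: contra z0 => /eqP [->].
have E : (y, (0 : Z)) |* r = ((0 : Y), z) |* s.
  by apply: (can_inj gK); rewrite !linear_ract rE sE.
have := uniserial_neq0 l0; rewrite -rE -linear_ract.
suff -> : (y, (0 : Z)) |* r = 0 by rewrite linear0 eqxx.
have E2 : (y |* r, (0 : Z) |* r) = ((0 : Y) |* s, z |* s) := E.
rewrite -[LHS]/(y |* r, (0 : Z) |* r); case: E2 => -> _.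
by rewrite !ract0.
Qed.

End Uniserial.

(** Realised as a quotient of the regular module: the submodule divided out contains [(1 - e_a) L],
    so [e_a L] needs no separate construction. *)
Lemma ex_uniserial a l : (l <= len a)%N -> exists M (u : M), uniserial a l u.
Proof.
move=> la; pose R : rmodType L := L^c^o.
have [|M [p [ps pS]]] := @ex_quotient _ R (fun y => exists z : L, e a * y = e a * X ^+ l * z).
  split=> [|c x y [z zE] [w wE]]; first by exists 0; rewrite !mulr0.
  exists (z * c + w); transitivity (e a * x * c + e a * y).
    by rewrite -mulrA -mulrDr.
  by rewrite zE wE mulrDr mulrA.
have pE (y : L) : p (1 : L) |* y = p y.
  by rewrite -linear_ract; congr (p _); exact: (@mul1r L y).
exists M, (p (1 : L)); split.
- rewrite pE; apply/eqP; rewrite -subr_eq0 -linearB; apply/eqP/pS; exists 0.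
  by rewrite mulr0 mulrBr eMid mulr1 subrr.
- by rewrite pE; apply/pS; exists 1; rewrite mulr1.
- move=> k kl; rewrite pE; apply/negP => /eqP /pS [z zE].
  have [c cE] := e_spanP (a + l%:Z) z.
  (* If [u X^k] were zero, [e_a X^k] would lie in [e_a X^l L]. Multiplied by this power it becomes
     [e_a X^(len a - 1)], which is nonzero, while the other side reaches degree [len a] because
     [k < l]. *)
  have : e a * X ^+ k * X ^+ ((len a).-1 - k) == 0.
    rewrite zE eXn -[X ^+ l * _ * z]mulrA cE mulr_sumr mulr_suml big1 // => j _.
    rewrite -scalerAr -scalerAl mulrA -eXn -!mulrA -!exprD.
    have /eqP -> : e a * X ^+ (l + (j + ((len a).-1 - k))) == 0.
      rewrite len_eq0; move: kl la => /=; lia.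
    by rewrite scaler0.
  rewrite -mulrA -exprD len_eq0; have := len_gt0 a; lia.
- by move=> z; have [y <-] := ps z; exists y; rewrite pE.
Qed.

Lemma uniserial_proj a M (u : M) : uniserial a (len a) u -> proj_mod M.
Proof.
move=> uM; split=> [|Y Z g f _ _ gs]; first exact: uniserial_fin_gen uM.
have [ue ul un ug] := uM; have [y yE] := gs (f u).
have [||h hE] := uniserial_map uM (v := y |* e a).
- by rewrite ractA eMid.
- rewrite ractA; have /eqP -> : e a * X ^+ len a == 0 by rewrite len_eq0.
  exact: ract0r.
exists h => z; have [r ->] := ug z.
by rewrite !linear_ract hE linear_ract yE -[f u |* e a]linear_ract ue.
Qed.

Lemma ract_Xe a M (u : M) k b : u |* e a = u ->
  u |* X ^+ k |* e b = if (a + k%:Z == b %[mod N%:Z])%Z then u |* X ^+ k else 0.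
Proof.
move=> ua; have uX : u |* X ^+ k = u |* X ^+ k |* e (a + k%:Z).
  by rewrite -{1}ua ractA eXn -ractA.
by rewrite uX ractA eM; case: ifP; rewrite ?ract0r.
Qed.

(** [psi] reads the coefficient at the socle, and the multiplier moves the coefficient at [u X^j]
    there. This form makes sense for any functional on any module, which is how maps are extended
    below. *)
Lemma uniserial_coef a l M (u : M) : uniserial a l.+1 u ->
  exists psi : {linear [M]_K -> K^o}, forall z : M,
    z = \sum_(j < l.+1) psi (z |* (e (a + j%:Z) * X ^+ (l - j))) %* (u |* X ^+ j).
Proof.
move=> uM; have [ue ul un ug] := uM.
pose W (z : [M]_K) := exists c : nat -> K, (z : M) = xsum l u c.
have [|||psi [psi0 psi1]] := @ex_functional_sep K L M W (u |* X ^+ l).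
- exact: uniserial_fin_gen uM.
- split=> [|c x y [b bE] [d dE]].
    by exists (fun=> 0); rewrite /xsum big1 // => k _; rewrite ksc0.
  exists (fun k => c * b k + d k).
  rewrite -[LHS]/(c %* (x : M) + (y : M)) bE dE /xsum ksc_sumr -big_split /=.
  by apply: eq_bigr => k _; rewrite kscA kscDl.
- case=> c cE.
  have := @xsum_indep l.+1 M u (fun k => if k == l then -1 else c k)
    l.+1 ul un _ l (ltnSn l) (ltnSn l).
  rewrite eqxx => H; have /eqP : -1 = 0 :> K; last by rewrite oppr_eq0 oner_eq0.
  apply: H; rewrite /xsum big_ord_recr /= eqxx.
  under eq_bigr => k _ do rewrite ltn_eqF //.
  by rewrite -/(xsum l u c) -cE [-1 %* _](scaleN1r (u |* X ^+ l : [M]_K)) subrr.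
have psiX k : (k < l.+1)%N -> psi (u |* X ^+ k) = (k == l)%:R.
  move=> kl; case: eqP => [->|kl1]; first exact: psi1.
  apply: psi0; exists (fun j => (j == k)%:R).
  have kP : (k < l)%N by lia.
  rewrite /xsum (bigD1 (Ordinal kP)) //= eqxx ksc1 big1 ?addr0 // => j jk.
  rewrite (_ : (j : nat) == k = false) ?ksc0 //.
  by apply: contraNF jk => /eqP jk; apply/eqP/val_inj.
exists psi => z; have [c zE] := uniserial_xsum uM z.
rewrite {1}zE; apply: eq_bigr => -[j jl] _ /=; congr (_ %* _).
have psiS (v : 'I_l.+1 -> M) :
    psi (\sum_(k < l.+1) c k %* v k) = \sum_(k < l.+1) c k * (psi (v k) : K).
  by rewrite (linear_sum psi); apply: eq_bigr => k _; rewrite [psi (_ %* _)]linearZ.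
rewrite zE /xsum ract_suml; under [X in psi X]eq_bigr => k _ do rewrite ksc_ract.
rewrite psiS (bigD1 (Ordinal jl)) //= -!ractA (ract_Xe _ _ ue) eqxx ractA -exprD subnKC //.
rewrite psiX // eqxx mulr1 big1 ?addr0 // => -[k kl] /= kj.
have {}kj : k != j by apply: contra kj => /eqP kj; apply/eqP/val_inj.
rewrite -!ractA (ract_Xe _ _ ue); case: ifP => _; last by rewrite ract0 linear0 mulr0.
rewrite ractA -exprD; have [lt|gt|/eqP] := ltngtP k j; last by rewrite (negbTE kj).
  rewrite psiX; last by lia.
  by rewrite (_ : (k + (l - j) == l)%N = false) ?mulr0 //; lia.
by rewrite (ract_X0 ul) ?linear0 ?mulr0 //; lia.
Qed.

(** The hypothesis says that the interval cannot be prolonged to the left. To extend [f], extend the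
    functional [psi \o f] over K and put it into the coefficient formula; linearity over [L] is what
    has to be checked. *)
Lemma uniserial_inj a l M (u : M) : uniserial a l u -> e (a - 1) * X ^+ l = 0 -> inj_mod M.
Proof.
case: l => [|l] uM al.
  by move: al; rewrite mulr1 => /eqP; rewrite (negbTE (e_neq0 _)).
have [ue ul un ug] := uM; split=> [|Y Z g f Yf Zf gi]; first exact: uniserial_fin_gen uM.
have [psi psiE] := uniserial_coef uM.
have [fk fkE] := ex_linear_over_field f.
have [phi phiE] := ex_functional_ext (psi \o fk : {linear [Y]_K -> K^o}) Zf gi.
pose h (z : Z) : M :=
  \sum_(j < l.+1) phi (z |* (e (a + j%:Z) * X ^+ (l - j))) %* (u |* X ^+ j).
have phiD (x y : Z) : phi (x + y) = phi x + phi y by exact: (linearD phi x y).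
have phiZ c (x : Z) : phi (c %* x) = c * phi x by exact: (linearZ_LR phi c x).
have [||||h' h'E] := @linear_of_eX Z M h.
- move=> x y; rewrite /h -big_split; apply: eq_bigr => j _ /=.
  by rewrite ractDl phiD kscDl.
- move=> c x; rewrite /h ksc_sumr; apply: eq_bigr => j _ /=.
  by rewrite ksc_ract phiZ kscA.
- move=> b x; rewrite /h ract_suml; apply: eq_bigr => j _.
  rewrite ksc_ract (ract_Xe _ _ ue) -!ractA [x |* e b |* _]ractA eM eq_sym.
  case: ifP => [/eqP /e_mod -> //|_].
  by rewrite ract0r ract0 (linear0 phi) ksc0 ksc0r.
- move=> x; rewrite /h ract_suml big_ord_recl [RHS]big_ord_recr /=.
  rewrite !ksc_ract subn0 [u |* _ |* X]ractA -exprSr ul ksc0r addr0.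
  have XeX b k : x |* X |* (e b * X ^+ k) = x |* (e (b - 1) * X ^+ k.+1).
    have XeE : X * e b = e (b - 1) * X by rewrite eX subrK.
    by rewrite ractA mulrA XeE -mulrA -exprS.
  (* Acting by [X] shifts the index [j]. At the far end [u X^(l+1) = 0]; at [j = 0] the extra term
     contains [e_(a-1) X^(l+1)], which [al] kills. *)
  rewrite XeX addr0 al ract0r (linear0 phi) ksc0 add0r.
  apply: eq_bigr => j _; rewrite XeX ksc_ract ractA -exprSr /bump /= add1n.
  congr (phi (x |* (e _ * X ^+ _)) %* _); first by lia.
  by have := ltn_ord j; lia.
exists h' => x; rewrite h'E [RHS]psiE /h; apply: eq_bigr => j _.
by rewrite -linear_ract phiE /= fkE linear_ract.
Qed.

Lemma uniserial_ses a k l M Q P (u : M) (v : Q) (w : P) :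
  uniserial a (k + l) u -> uniserial (a + k%:Z) l v -> uniserial a k w ->
  exists (i : {linear Q -> M}) (p : {linear M -> P}), ses i p.
Proof.
move=> uM vQ wP; have [[ue ul un ug] [ve vl vn vg] [we wl wn wg]] := And3 uM vQ wP.
have [||i iE] := uniserial_map vQ (v := u |* X ^+ k).
- by rewrite (ract_Xe _ _ ue) eqxx.
- by rewrite ractA -exprD.
have [||p pE] := uniserial_map uM (v := w) => //.
  by rewrite exprD -ractA wl ract0.
exists i, p; split.
- case: (posnP l) => [l0|l0].
    by move=> x y _; rewrite (uniserial_zero vQ _ x) ?l0 // (uniserial_zero vQ _ y) ?l0.
  apply: (uniserial_map_inj vQ); rewrite linear_ract iE ractA -exprD; apply: un; lia.
- exact: (uniserial_surj wP pE).
move=> z; split=> [pz|[x <-]]; last first.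
  have [y ->] := vg x; rewrite !linear_ract iE linear_ract pE.
  by rewrite wl ract0.
have [c zE] := uniserial_xsum uM z.
have p0 : xsum (k + l) w c = 0.
  rewrite -pz zE /xsum linear_sum; apply: eq_bigr => j _.
  by rewrite linear_ksc linear_ract pE.
exists (\sum_(j < l) c (k + j)%N %* (v |* X ^+ j)).
rewrite zE /xsum big_split_ord /= [X in _ = X + _]big1 ?add0r => [|j _]; last first.
  by rewrite (xsum_indep wl wn p0) ?ksc0 //=; have := ltn_ord j; lia.
rewrite linear_sum; apply: eq_bigr => j _.
by rewrite linear_ksc linear_ract iE ractA -exprD.
Qed.

(** The idempotent that fixes the socle determines the right end modulo [N], and a map that is
    nonzero on the socle preserves it. *)
Lemma uniserial_end a b k l M Q (u : M) (v : Q) (h : {linear M -> Q}) :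
  uniserial a l u -> uniserial b k v -> (0 < l)%N -> h (u |* X ^+ l.-1) != 0 ->
  (a + l%:Z = b + k%:Z %[mod N%:Z])%Z.
Proof.
move=> uM vQ l0 hs; have [[ue ul un ug] [ve vl vn vg]] := (uM, vQ).
have hX : h (u |* X ^+ l.-1) |* X = 0.
  by rewrite -linear_ract ractA -exprSr prednK // ul linear0.
have [c cE] := uniserial_socle_scalar vQ hX.
have k0 : (0 < k)%N by have [] := uniserial_socle vQ hs.
have : h (u |* X ^+ l.-1) |* e (a + l.-1%:Z) != 0.
  by rewrite -linear_ract (ract_Xe _ _ ue) eqxx.
rewrite cE ksc_ract (ract_Xe _ _ ve); case: ifP => [/eqP eq _|]; last by rewrite ksc0r eqxx.
have -> : a + l%:Z = a + l.-1%:Z + 1 by lia.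
have -> : b + k%:Z = b + k.-1%:Z + 1 by lia.
by rewrite -[in LHS]modzDml -eq modzDml.
Qed.

(** Otherwise [a, a + l) embeds in [a - 1, a + l), and a retraction would send the nonzero socle
    element [v X^l] into [M X^l = 0]. *)
Lemma uniserial_injE a l M (u : M) : uniserial a l u -> (0 < l)%N -> inj_mod M ->
  e (a - 1) * X ^+ l = 0.
Proof.
move=> uM l0 [Mf Me]; have [ue ul un ug] := uM; apply/eqP; rewrite len_eq0 leqNgt.
apply/negP => lt; have [Q [v vQ]] := ex_uniserial lt; have [ve vl vn vg] := vQ.
have [||i iE] := uniserial_map uM (v := v |* X).
- by rewrite -[X]expr1 (ract_Xe _ _ ve) subrK eqxx.
- by rewrite ractA -exprS.
have iX : i (u |* X ^+ l.-1) = v |* X ^+ l.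
  by rewrite linear_ract iE ractA -exprS prednK.
have ii : injective i by apply: (uniserial_map_inj uM); rewrite iX vn.
have [r rE] := Me M Q i (idfun : {linear M -> M}) Mf (uniserial_fin_gen vQ) ii.
have /eqP := uniserial_neq0 uM l0; apply.
by rewrite -[LHS]/(idfun _) -rE iX linear_ract (uniserial_ractX0 uM).
Qed.

(** * Simple quotients and decomposition of projective modules *)

Lemma ex_top M : fin_gen M -> ~ zero_mod M ->
  exists a (v : M) (phi : {linear [M]_K -> K^o})
    (S : rmodType L) (s : S) (q : {linear M -> S}),
    [/\ uniserial a 1 s, v |* e a = v, phi v = 1 & forall x, q x = phi x %* s].
Proof.
move=> Mf M0.
(* Nakayama's lemma: [M = M X] would give [M = M X^m = 0]. *)
have [v0 v0P] : exists v, ~ exists w : M, v = w |* X.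
  apply: contrapT => h; apply: M0 => x.
  have xk k : exists w : M, x = w |* X ^+ k.
    elim: k => [|k [w ->]]; first by exists x; rewrite expr0 ract1.
    have [w' ->] : exists w' : M, w = w' |* X by apply: contrapT => h'; apply: h; exists w.
    by exists w'; rewrite ractA -exprS.
  by have [w ->] := xk m; rewrite X_nil ract0r.
have [a vP] : exists a, ~ exists w : M, v0 |* e a = w |* X.
  apply: contrapT => h; apply: v0P.
  have /choice [w wE] : forall a, exists w : M, v0 |* e a = w |* X.
    by move=> a; apply: contrapT => h'; apply: h; exists a.
  exists (\sum_(i < N) w i%:Z); rewrite -[LHS]ract1 -e_sum ract_sumr ract_suml.
  by apply: eq_bigr => i _.
(* [W] contains [M X] and all [M e_b] with [b] different from [a] modulo [N], so a functional
   vanishing on [W] gives a map onto the simple module at [a]. *)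
pose v := v0 |* e a; pose W (x : [M]_K) := exists w : M, (x : M) |* e a = w |* X.
have [|[w wE]|phi [phiW phiv]] := @ex_functional_sep K L M W v Mf.
- split=> [|c x y [w wE] [w' w'E]]; first by exists 0; rewrite !ract0.
  exists (c %* w + w'); rewrite -[_ *: _ + _]/(c %* (x : M) + (y : M)).
  by rewrite !ractDl !ksc_ract wE w'E.
- by apply: vP; exists w; rewrite -wE /v ractA eMid.
have [S [s sS]] := ex_uniserial (len_gt0 a); have [se sX _ _] := sS.
rewrite expr1 in sX.
have phiD (x y : M) : phi (x + y) = phi x + phi y by exact: (linearD phi x y).
have phiZ c (x : M) : phi (c %* x) = c * phi x by exact: (linearZ_LR phi c x).
have se' b : s |* e b = if (a == b %[mod N%:Z])%Z then s else 0.
  by have := ract_Xe 0 b se; rewrite expr0 ract1 addr0.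
have phie (x : M) : phi (x |* e a) = phi x.
  have : phi (x |* e a + -1 %* x) = 0.
    apply: phiW; exists 0; rewrite ractDl ksc_ract ractA eMid ract0.
    by rewrite [-1 %* _](scaleN1r (x |* e a : [M]_K)) subrr.
  by rewrite phiD phiZ mulN1r => /eqP; rewrite subr_eq0 => /eqP.
have [||||q qE] := @linear_of_eX M S (fun x => phi x %* s).
- by move=> x y; rewrite phiD kscDl.
- by move=> c x; rewrite phiZ kscA.
- move=> b x; rewrite ksc_ract se'; case: ifP => [/eqP /e_mod <-|ab]; first by rewrite phie.
  rewrite ksc0r phiW ?ksc0 //; exists 0.
  by rewrite ractA eM eq_sym ab ract0r ract0.
- move=> x; rewrite ksc_ract sX ksc0r phiW ?ksc0 //; exists (x |* e (a - 1)).
  by rewrite !ractA eX subrK.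
by exists a, v, phi, S, s, q; split=> //; rewrite /v ractA eMid.
Qed.

Lemma ex_top_ses M : fin_gen M -> ~ zero_mod M ->
  exists a (S Q : rmodType L) (s : S) (q : {linear M -> S}) (i : {linear Q -> M}),
    [/\ uniserial a 1 s, ses i q &
        forall d, kspan d M -> (0 < d)%N /\ kspan d.-1 Q].
Proof.
move=> Mf M0; have [a [v [phi [S [s [q [sS va phiv qE]]]]]]] := ex_top Mf M0.
have qs : surj q by apply: (uniserial_surj sS (x := v)); rewrite qE phiv ksc1.
have [Q [i iq]] := ex_kernel qs.
exists a, S, Q, s, q, i; split=> // d; apply: (kspan_ker (v := v) (phi := phi) iq).
  move=> x; rewrite qE; have s0 : s != 0.
    by have := uniserial_neq0 sS isT; rewrite expr0 ract1.
  split=> [/eqP|->]; last by rewrite ksc0.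
  by rewrite ksc_eq0 (negbTE s0) orbF => /eqP.
by rewrite phiv oner_eq0.
Qed.

Definition indec_proj M : Prop := exists a (u : M), uniserial a (len a) u.

(** A simple quotient of [P] lifts to a map onto its projective cover [e_a L], which splits off; the
    complement is spanned by fewer elements. *)
Lemma proj_mod_dsum P : proj_mod P -> dsum indec_proj P.
Proof.
move=> Pp; have [d dP] := fin_gen_kspan Pp.1.
elim: d P Pp dP => [|d IH] P Pp dP.
  have [P0|P0] := pselect (zero_mod P); first exact: dsum_zero.
  by have [a [S [Q [s [q [i [_ _ /(_ 0 dP) []]]]]]]] := ex_top_ses Pp.1 P0.
have [P0|P0] := pselect (zero_mod P); first exact: dsum_zero.
have [a [v [phi [S [s [q [sS va phiv qE]]]]]]] := ex_top Pp.1 P0.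
have s0 : s != 0 by have := uniserial_neq0 sS isT; rewrite expr0 ract1.
have qv : q v = s by rewrite qE phiv ksc1.
have qs : surj q by apply: (uniserial_surj sS qv).
have [M [u uM]] := ex_uniserial (leqnn (len a)); have [ue ul un ug] := uM.
have Mp := uniserial_proj uM.
have [se sX _ _] := sS; rewrite expr1 in sX.
have [||t tE] := uniserial_map uM (v := s) => //.
  by rewrite -(prednK (len_gt0 a)) exprS -ractA sX ract0.
have ts : surj t by apply: (uniserial_surj sS tE).
have [h hE] := Pp.2 M S t q Mp.1 (uniserial_fin_gen sS) ts.
have [c hv] := uniserial_xsum uM (h v).
have c0 : c 0%N = 1.
  have : t (h v) = c 0%N %* s.
    rewrite hv /xsum linear_sum -(prednK (len_gt0 a)) big_ord_recl /=.
    rewrite linear_ksc linear_ract tE expr0 ract1 big1 ?addr0 // => k _.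
    by rewrite linear_ksc linear_ract tE exprS -ractA sX ract0 ksc0r.
  rewrite hE qv => e1; have : (c 0%N - 1) %* s == 0.
    by rewrite kscDl -e1 [-1 %* _](scaleN1r (s : [S]_K)) subrr.
  by rewrite ksc_eq0 (negbTE s0) orbF subr_eq0 => /eqP.
(* Since [h v] is [u] plus higher terms, [u X^j] lies in the image of [h] once all later [u X^i] do;
   hence a descent from [j = len a]. *)
have him n j : (len a - j <= n)%N -> exists x, h x = u |* X ^+ j.
  elim: n j => [|n IHn] j; first by exists 0; rewrite linear0 (ract_X0 ul) //; lia.
  move=> jn; have /choice [w wE] : forall k, exists x, h x = u |* X ^+ (k.+1 + j).
    by move=> k; apply: IHn; lia.
  exists (v |* X ^+ j + -1 %* \sum_(k < (len a).-1) c k.+1 %* w k).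
  rewrite linearD linear_ksc linear_ract hv /xsum linear_sum.
  rewrite -(prednK (len_gt0 a)) big_ord_recl /=.
  rewrite ractDl c0 ksc1 expr0 ract1 ract_suml [-1 %* _](scaleN1r (_ : [M]_K)).
  rewrite -addrA -[RHS]addr0.
  congr (_ + _); apply/eqP; rewrite subr_eq0; apply/eqP; apply: eq_bigr => k _.
  by rewrite linear_ksc wE ksc_ract ractA -exprD.
have hs : surj h.
  have [x hx] := him (len a) 0%N (leq_subr _ _).
  by apply: (uniserial_surj uM (x := x)); rewrite hx expr0 ract1.
have [Q [i ih]] := ex_kernel hs; have [ii _ eih] := ih.
have PMQ := proj_ses_split ih Pp.1 Mp.
have dPK : retract Q (M * Q)%type.
  have [z zE] := ex_null Q M; have [j jE] := ex_pair z idfun.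
  by exists j, snd => x; rewrite /= jE.
apply: dsum_cons (PMQ); first by exists a, u.
apply: IH.
  apply: proj_mod_retract dPK _.
  exact: proj_mod_retract (iso_retract (iso_sym PMQ)) Pp.
have [si siE] := Mp.2 P M h (idfun : {linear M -> M}) Pp.1 Mp.1 hs.
have [r rE] : exists r : {linear P -> Q}, forall x, i (r x) = x - si (h x).
  have [|k kE] := @mk_linear _ P P (fun x => x - si (h x)).
    by move=> b x y; rewrite [h _]linearP [si _]linearP scalerBr opprD addrACA.
  have [|r rE] := @linear_lift_inj _ P Q P i k ii; last by exists r => x; rewrite rE kE.
  by move=> x; apply/eih; rewrite kE linearB siE subrr.
(* The complement [Q] is a quotient of [ker q]: elements killed by [h] are killed by [q], and
   [ker q] is spanned by one element less than [P]. *)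
have [Q0 [j jq]] := ex_kernel qs; have [_ _ ejq] := jq.
have [_ dQ0] : (0 < d.+1)%N /\ kspan d Q0.
  apply: (kspan_ker (v := v) (phi := phi) jq) dP; last by rewrite phiv oner_eq0.
  move=> x; rewrite qE; split=> [/eqP|->]; last by rewrite ksc0.
  by rewrite ksc_eq0 (negbTE s0) orbF => /eqP.
apply: (kspan_surj (h := r \o j : {linear Q0 -> Q}) _ dQ0) => y.
have hi : h (i y) = 0 by apply/eih; exists y.
have /ejq [z zE] : q (i y) = 0 by rewrite -hE hi linear0.
by exists z; apply: ii; rewrite /= rE zE hi linear0 subr0.
Qed.

(** * Syzygies and global dimension *)

Lemma uniserial_proj_dim_le J (s0 s1 : int) M (u : M) : s0 <= s1 -> s1 <= lend s0 ->
  alt lend s0 s1 J = alt lend s0 s1 J.+1 -> uniserial s0 `|s1 - s0|%N u -> proj_dim_le J M.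
Proof.
(* Equality of the two terms means that the [J]-th syzygy is an empty interval; [altS] passes from
   [s0, s1) to its syzygy [s1, lend s0). *)
elim: J s0 s1 M u => [|J IH] s0 s1 M u s01 s1l.
  rewrite /alt /= => e01 uM; apply: proj_mod_zero; apply: (uniserial_zero uM).
  by rewrite e01 subrr.
rewrite [alt lend s0 s1 J.+1]altS [alt lend s0 s1 J.+2]altS => eJ uM.
have [P [v vP]] := ex_uniserial (leqnn (len s0)).
have le2 := lend_mono s01.
have [|Q [w wQ]] := @ex_uniserial s1 `|lend s0 - s1|%N.
  by move: le2 s1l; rewrite /lend; lia.
have lE : len s0 = (`|s1 - s0| + `|lend s0 - s1|)%N by move: s1l; rewrite /lend; lia.
have sE : s1 = s0 + `|s1 - s0|%N%:Z by lia.
have wQ' := wQ; rewrite {1}sE in wQ'; have vP' := vP; rewrite lE in vP'.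
have [i [p ip]] := uniserial_ses vP' wQ' uM.
exists P, Q, i, p; split=> //; first exact: uniserial_proj vP.
exact: IH s1l le2 eJ wQ.
Qed.

Lemma kspan_fin_gen d M : kspan d M -> fin_gen M.
Proof.
move=> [s sP]; apply/fin_genP.
have [|k kE] := @mk_linear _ 'rV[L^c]_d M (fun v => \sum_i v 0 i *: s i).
  move=> c x y; rewrite scaler_sumr -big_split /=; apply: eq_bigr => i _.
  by rewrite !mxE scalerDl scalerA.
exists d, k => x; have [c ->] := sP x; exists (\row_i ((c i)%:A : L)).
by rewrite kE; apply: eq_bigr => i _; rewrite mxE.
Qed.

(** Simple modules are the intervals [a, a + 1), to which the hypothesis applies; a composition
    series and the horseshoe lemma carry the same [B] to all modules. *)
Lemma gl_dim_finite B :
  (forall s0 s1 : int, s0 <= s1 -> s1 <= lend s0 ->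
     exists2 J, (J <= B)%N & alt lend s0 s1 J = alt lend s0 s1 J.+1) ->
  gl_dim L <> infty.
Proof.
move=> HB; have simple a (S : rmodType L) (s : S) : uniserial a 1 s -> proj_dim_le B S.
  move=> sS; have a1 : a <= a + 1 by lia.
  have a2 : a + 1 <= lend a by have := lend_gt a; lia.
  have [J JB eJ] := HB _ _ a1 a2; apply: proj_dim_le_leq JB _.
  by apply: (uniserial_proj_dim_le a1 a2 eJ (u := s)); rewrite addrAC subrr.
have zero M : zero_mod M -> proj_dim_le B M.
  by move=> M0; apply: (@proj_dim_le_leq _ 0) => //; apply: proj_mod_zero.
have all d M : kspan d M -> proj_dim_le B M.
  elim: d M => [|d IH] M dM; have Mf := kspan_fin_gen dM;
    have [M0|M0] := pselect (zero_mod M); try exact: zero;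
    have [a [S [Q [s [q [i [sS iq dQ]]]]]]] := ex_top_ses Mf M0;
    have [d0 {}dQ] := dQ _ dM => //.
  exact: proj_dim_le_ses iq (IH _ dQ) (simple _ _ _ sS).
suff : ele (gl_dim L) (fin_enat B) by case: (gl_dim L).
apply: esup_lub => _ [M Mf ->]; have [d dM] := fin_gen_kspan Mf.
exact/ele_proj_dim/(all d).
Qed.

Lemma ele_trans (x y z : enat) : ele x y -> ele y z -> ele x z.
Proof. by case: x y z => [x|] [y|] [z|] //=; apply: leq_trans. Qed.

Lemma einf_fin (S : enat -> Prop) n : einf S = fin_enat n -> S (fin_enat n).
Proof.
by rewrite /einf; case: pselect => // h [<-]; case: ex_minnP => k /asboolP.
Qed.

(** * Coresolutions of the indecomposable projectives *)

Section Adjoint.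
Variable g : int -> int.
Hypothesis gf : forall a b : int, (g b <= a) = (b <= lend a).

Lemma hull_inj b M (u : M) : uniserial (g b) `|b - g b|%N u -> inj_mod M.
Proof.
move=> uM; apply: uniserial_inj uM _; apply/eqP; rewrite len_eq0.
by have := gf (g b - 1) b; have := gf (g b) b; rewrite /lend; lia.
Qed.

Lemma hull_injE a b M (u : M) : a < b -> uniserial a `|b - a|%N u -> inj_mod M -> g b = a.
Proof.
move=> ab uM Mi; have l0 : (0 < `|b - a|)%N by lia.
have /eqP := uniserial_injE uM l0 Mi; rewrite len_eq0.
have := uniserial_le_len uM; have := gf (a - 1) b; have := gf a b; rewrite /lend; lia.
Qed.

Lemma hull_ses p q M (u : M) : p < q -> q <= lend p -> uniserial p `|q - p|%N u ->
  exists (I Q : rmodType L) (x : I) (y : Q) (i : {linear M -> I}) (r : {linear I -> Q}),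
    [/\ uniserial (g q) `|q - g q|%N x, uniserial (g q) `|p - g q|%N y, ses i r,
        inj_mod I & lend (g q) = q -> proj_mod I].
Proof.
move=> pq ql uM; have gp : g q <= p by rewrite gf.
have ql' : q <= lend (g q) by rewrite -gf.
have [|I [x xI]] := @ex_uniserial (g q) `|q - g q|%N; first by move: ql'; rewrite /lend; lia.
have [|Q [y yQ]] := @ex_uniserial (g q) `|p - g q|%N; first by move: ql'; rewrite /lend; lia.
have lE : `|q - g q|%N = (`|p - g q| + `|q - p|)%N by lia.
have sE : p = g q + `|p - g q|%N%:Z by lia.
have uM' := uM; rewrite {1}sE in uM'; have xI' := xI; rewrite lE in xI'.
have [i [r ir]] := uniserial_ses xI' uM' yQ.
exists I, Q, x, y, i, r; split=> //; first exact: hull_inj xI.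
move=> lq; apply: (@uniserial_proj (g q) I x); have -> // : len (g q) = `|q - g q|%N.
by move: lq; rewrite /lend; lia.
Qed.

Lemma ex_pi_cosyz d p q M (u : M) : q <= lend p ->
  (forall i, (i < d)%N -> lend (alt g q p i.+2) = alt g q p i) ->
  (forall i, (i <= d)%N -> alt g q p i.+1 < alt g q p i) ->
  uniserial p `|q - p|%N u ->
  exists (C : rmodType L) (w : C),
    uniserial (alt g q p d.+1) `|alt g q p d - alt g q p d.+1|%N w /\ pi_cosyz d M C.
Proof.
elim: d p q M u => [|d IH] p q M u ql Hf Hl uM.
  by exists M, u; split=> //; constructor.
have pq : p < q by have := Hl 0%N isT.
have [I [Q [x [y [i [r [xI yQ ir Ii Ip]]]]]]] := hull_ses pq ql uM.
have lq : lend (g q) = q by have := Hf 0%N isT.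
have [|j jd|j jd|C [w [wC QC]]] := IH (g q) p Q y _ _ _ yQ.
- by rewrite lq ltW.
- by rewrite -!altS Hf.
- by rewrite -!altS Hl.
exists C, w; rewrite [alt g q p d.+2]altS [alt g q p d.+1]altS; split=> //.
apply: pi_cosyzS ir (Ip lq) Ii (uniserial_fin_gen uM) QC.
Qed.

Section Coresolution.
Variables (a : int) (M : rmodType L) (u : M) (d : nat).
Local Notation T := (alt g (lend a) a).
Hypotheses (uM : uniserial a (len a) u) (gfa : g (lend a) < a).
Hypothesis Td : forall i, (i < d)%N -> lend (T i.+2) = T i.
Hypothesis nTd : lend (T d.+2) <> T d.

Lemma ex_pi_cosyz_proj : exists (C : rmodType L) (w : C),
  [/\ uniserial (T d.+1) `|T d - T d.+1|%N w, pi_cosyz d M C & T d.+1 < T d].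
Proof.
have lt := alt_g_lt lend_mono lend_gt gfa Td.
have [||||C [w [wC MC]]] := @ex_pi_cosyz d a (lend a) M u => //.
  by have -> : `|lend a - a|%N = len a by rewrite /lend; lia.
by exists C, w; split=> //; apply: lt.
Qed.

(** If the term in degree [d] were projective, the cosyzygy [T_(d+1), T_d) would embed in a
    projective, and comparing socles [T_d] would be a value of [lend]; then [fgf] contradicts
    [nTd]. *)
Lemma dom_dim_proj_le : ele (dom_dim_mod M) (fin_enat d).
Proof.
apply: esup_lub => _ [t -> [I _ Ip]] /=; rewrite leqNgt; apply/negP => dt.
have [C [w [wC MC lt]]] := ex_pi_cosyz_proj.
have [P [i [Pp ii]]] := pi_cosyz_embed (uniserial_fin_gen uM) MC (Ip d dt).
have l0 : (0 < `|T d - T d.+1|)%N by lia.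
have nz := uniserial_neq0 wC l0.
have inz : i (w |* X ^+ (`|T d - T d.+1|).-1) != 0.
  by apply: contra nz => /eqP h; apply/eqP/ii; rewrite h linear0.
have [Y [h [[b [v vY]] hnz]]] := dsum_detect (proj_mod_dsum Pp) inz.
have := uniserial_end wC vY l0 hnz.
have -> : T d.+1 + `|T d - T d.+1|%N%:Z = T d by lia.
rewrite -/(lend b) => eT; apply: nTd; rewrite altSS.
have eq_mod (x y : int) : (x = y %[mod N%:Z])%Z ->
    x = y + ((x %/ N%:Z)%Z - (y %/ N%:Z)%Z) * N%:Z.
  move=> e0; rewrite mulrBl; have := divz_eq x N%:Z; have := divz_eq y N%:Z; rewrite e0.
  by move: (_ * _) (_ * _) (_ %% _)%Z => z1 z2 z3; lia.
rewrite (eq_mod _ _ eT) -(f_perM lend_per).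
exact: fgf lend_mono gf _.
Qed.

(** The [d]-th cosyzygy becomes injective, so the interval [T_(d+1), T_d) is its own hull. *)
Lemma inj_dim_proj_le : ele (inj_dim M) (fin_enat d) -> T d.+1 = g (T d).
Proof.
case E : (inj_dim M) => [n|] //= nd.
have [_ [<-] [J J0]] := einf_fin E.
have [C [w [wC MC lt]]] := ex_pi_cosyz_proj.
have Ci := pi_cosyz_inj (uniserial_fin_gen uM) MC nd J0.
by apply/esym/(hull_injE lt wC).
Qed.

End Coresolution.

(** The lower bound on the dominant dimension, for possibly decomposable [P]: the coresolutions of
    the summands run in parallel, those of injective summands stopping after one term. *)
Lemma ex_minimal_ir k P : proj_mod P ->
  (forall a M (u : M), uniserial a (len a) u -> inj_mod M \/
     forall j, (j < k)%N -> lend (alt g (lend a) a j.+2) = alt g (lend a) a j) ->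
  exists2 I : inj_resolution P, minimal_ir I & forall j, (j < k)%N -> proj_mod (I j).
Proof.
move=> Pp Hk.
(* An interval [p, q) with [k] projective terms ahead. The first hull is treated apart, because the
   condition on the chain is imposed only if the cosyzygy is nonzero, that is, if [g q < p]. *)
pose B k (M : rmodType L) := exists p q (u : M), [/\ p < q, q <= lend p,
  uniserial p `|q - p|%N u, (0 < k)%N -> lend (g q) = q &
  g q < p -> forall j, (j < k)%N -> lend (alt g q p j.+2) = alt g q p j].
apply: (minimal_ir_exists (C := fun k => dsum (B k))) => [k' M dM|].
  apply: dsum_cosyz_step dM => Y [p [q [u [pq ql uY Hq Hj]]]].
  have [I [Q [x [y [i [r [xI yQ ir Ii Ip]]]]]]] := hull_ses pq ql uY.
  exists I, Q, i, r; split=> //.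
  - apply: (uniserial_essential xI); first by case: ir.
    by move=> Y0; have /eqP := uniserial_neq0 uY ltac:(lia); apply; apply: Y0.
  - by move=> k0; apply: Ip; apply: Hq.
  have gp : g q <= p by rewrite gf.
  case: (ltP (g q) p) => [gltp|pg]; last first.
    by right; apply: (uniserial_zero yQ); lia.
  left; exists (g q), p, y; split=> //.
  - by have := gf (g q) q; lia.
  (* Index 1 concerns the hull of the next interval: [alt g q p 3] is [g p] and [alt g q p 1] is
     [p]. *)
  - by move=> k1; have := Hj gltp 1%N; rewrite /alt /=; apply; lia.
  - by move=> _ j jk; rewrite -!altS Hj //; lia.
apply: dsum_sub (proj_mod_dsum Pp) => Y [a [u uY]].
have uY' : uniserial a `|lend a - a|%N u.
  by have -> : `|lend a - a|%N = len a by rewrite /lend; lia.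
exists a, (lend a), u; split=> //.
- exact: lend_gt.
- by move=> _; apply: fgf lend_mono gf _.
case: (Hk a Y u uY) => // /(hull_injE (lend_gt a) uY') ->.
by rewrite ltxx.
Qed.

End Adjoint.

Lemma proj_mod_regular (R : nzRingType) : proj_mod (R^o).
Proof.
split=> [|Y Z g f Yf Zf gs].
  by exists [:: 1] => x; exists (fun=> x); rewrite big_ord1 /= -[_ *: _]/(_ * _) mulr1.
have [y yE] := gs (f 1).
have [|h hE] := @mk_linear R R^o Y (fun c => c *: y).
  by move=> c a b; rewrite scalerDl scalerA.
by exists h => x; rewrite hE linearZ yE -linearZ -[_ *: _]/(_ * _) mulr1.
Qed.

Lemma nakayama_dom_dim_even : gl_dim L = infty -> dominant_auslander_gorenstein L ->
  exists d, dom_dim L = fin_enat d /\ ~~ odd d.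
Proof.
move=> gl [_ DAG]; rewrite /dom_dim; case: asboolP => [_|nself]; first by exists 0%N.
have fm := lend_mono; have fl := lend_gt; have fp := lend_per.
have /choice [g gf] := ex_adjoint fm fl fp N_gt0.
have {}gf (a b : int) : (g b <= a) = (b <= lend a) := gf b a.
have noninj a M (u : M) : uniserial a (len a) u -> ~ inj_mod M ->
    g (lend a) < a /\ exists d, (forall i, (i < d)%N ->
      lend (alt g (lend a) a i.+2) = alt g (lend a) a i) /\
      lend (alt g (lend a) a d.+2) <> alt g (lend a) a d.
  move=> uM Mi; have gfa : g (lend a) < a.
    rewrite lt_neqAle gf lexx andbT; apply/eqP => ga; apply: Mi.
    apply: (@hull_inj g gf (lend a) M u); rewrite ga.
    by have -> : `|lend a - a|%N = len a by rewrite /lend; lia.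
  split=> //; have ex := coresolution_finite fm fp N_gt0 gfa.
  case: (ex_minnP ex) => d /eqP nd dmin; exists d; split=> // i id.
  by apply/eqP/negPn/negP => /dmin; rewrite leqNgt id.
set S := (X in einf X).
have [a0 [M0 [u0 [uM0 nM0]]]] : exists a M (u : M), uniserial a (len a) u /\ ~ inj_mod M.
  apply: contrapT => H; apply: nself.
  apply: dsum_inj (proj_mod_dsum (proj_mod_regular _)) => Y [a [u uY]].
  by apply: contrapT => nY; apply: H; exists a, Y, u.
have Sle a M (u : M) : uniserial a (len a) u -> ~ inj_mod M -> ele (einf S) (dom_dim_mod M).
  by move=> uM Mi; apply: einf_lb; exists M => //; split=> //; apply: uniserial_proj uM.
have [d dE] : exists d, einf S = fin_enat d.
  have [gfa [d0 [Td nTd]]] := noninj _ _ _ uM0 nM0.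
  have := ele_trans (Sle _ _ _ uM0 nM0) (dom_dim_proj_le gf uM0 gfa Td nTd).
  by case: (einf S) => // d _; exists d.
exists d; split=> //.
have [P [Pp Pi] PE] := einf_fin dE.
(* [P] may be decomposable, but some non-injective indecomposable summand must fail within [d]
   steps: otherwise [P] would have [d + 1] projective terms. *)
have [a [M [u [uM nM [gfa [d' [dd' [Td nTd]]]]]]]] : exists a M (u : M),
    [/\ uniserial a (len a) u, ~ inj_mod M & g (lend a) < a /\ exists d', (d' <= d)%N /\
     ((forall i, (i < d')%N -> lend (alt g (lend a) a i.+2) = alt g (lend a) a i) /\
      lend (alt g (lend a) a d'.+2) <> alt g (lend a) a d')].
  apply: contrapT => H.
  have [|I Im Ip] := @ex_minimal_ir g gf d.+1 P Pp.
    move=> a M u uM; have [Mi|Mi] := pselect (inj_mod M); [by left | right] => j jd.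
    have [gfa [d' [Td nTd]]] := noninj _ _ _ uM Mi.
    apply: (Td); rewrite ltnNge; apply/negP => d'j; apply: H; exists a, M, u; split=> //.
    by split=> //; exists d'; split; [lia | split].
  have : ele (fin_enat d.+1) (dom_dim_mod P) by apply: esup_ub; exists d.+1 => //; exists I.
  by rewrite -PE /= ltnn.
have le_d' := dom_dim_proj_le gf uM gfa Td nTd.
(* [M] itself competes in the infimum, which gives the other inequality. *)
have eqd : d = d'.
  have := ele_trans (Sle _ _ _ uM nM) le_d'; rewrite dE /= => d1.
  by apply/eqP; rewrite eqn_leq d1 dd'.
apply/negP => od.
have Mind := uniserial_indecomposable uM (len_gt0 a).
have := ele_trans (DAG M (uniserial_proj uM) Mind) le_d'.
move=> /(inj_dim_proj_le gf uM gfa Td nTd) Tg.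
have d'E : d' = (d'./2).*2.+1 by rewrite -[LHS]odd_double_half -eqd od.
rewrite d'E in Td Tg.
have col := odd_collapse Td Tg.
have [B BP] := chain_bound fm fl fp N_gt0 gf col.
exact: gl_dim_finite BP gl.
Qed.

End Nakayama.

(** * Presentation of a cyclic Nakayama algebra *)

Section CycleAlgebra.
Variables (K : fieldType) (n : nat).
Local Notation Q := (cycle_quiver n).
Local Notation KQ := (path_algebra K Q).

Definition idem (v : 'I_n.+1) : KQ := path_elt K (@trivial_path Q v).

Lemma arrow_walk (v : 'I_n.+1) : @is_walk Q v [:: v].
Proof. by rewrite /= eqxx. Qed.

Definition arrow_path (v : 'I_n.+1) : qpath Q := @QPath Q (v, [:: v]) (arrow_walk v).

Definition arrow_sum : KQ := \sum_(v < n.+1) path_elt K (arrow_path v).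

Lemma idemM v w : idem v * idem w = if v == w then idem v else 0.
Proof. by rewrite /idem path_eltM qcomp_triv /=; case: (v == w). Qed.

Lemma sum_idem : \sum_v idem v = 1.
Proof. by rewrite -[RHS]/(pa_one K Q) pa_one.unlock. Qed.

Lemma idem_arrow v : idem v * arrow_sum = path_elt K (arrow_path v).
Proof.
rewrite /arrow_sum mulr_sumr (bigD1 v) //= big1 ?addr0 => [|w wv].
  by rewrite path_eltM triv_qcomp eqxx.
by rewrite path_eltM triv_qcomp [qstart _]/= eq_sym (negbTE wv).
Qed.

Lemma arrow_idem v : arrow_sum * idem (ordS v) = path_elt K (arrow_path v).
Proof.
rewrite /arrow_sum mulr_suml (bigD1 v) //= big1 ?addr0 => [|w wv].
  by rewrite path_eltM qcomp_triv [qend _]/= eqxx.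
rewrite path_eltM qcomp_triv [qend _]/=; case: eqP => // /(@ordS_inj n.+1) wv'.
by rewrite wv' eqxx in wv.
Qed.

Lemma path_elt_arrow v (p p' : qpath Q) : qstart p = ordS v ->
  val p' = (v, v :: (val p).2) ->
  path_elt K p' = path_elt K (arrow_path v) * path_elt K p.
Proof.
move=> pv pp'; rewrite path_eltM qcompP pv [qend _]/= eqxx.
have e : ((val (arrow_path v)).1, (val (arrow_path v)).2 ++ (val p).2) = val p' by rewrite pp'.
by rewrite e valK.
Qed.

(** On a cycle each vertex starts exactly one arrow, so a path is determined by its source and its
    length. *)
Lemma path_elt_idem (p : qpath Q) :
  path_elt K p = idem (qstart p) * arrow_sum ^+ qlen p.
Proof.
rewrite /qstart /qlen; move E : (val p).2 => s; elim: s p E => [|a s IH] p E.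
  rewrite mulr1; congr (path_elt K _); apply: val_inj.
  by apply: etrans (surjective_pairing _) _; congr (_, _); exact: E.
have := qpathP p; rewrite -[qpath_val p]/(val p) E => /= /andP [/eqP av ws].
pose p1 : qpath Q := @QPath Q (ordS (val p).1, s)
  (etrans (congr1 (fun b => @is_walk Q (ordS b) s) (esym av)) ws).
rewrite (@path_elt_arrow (val p).1 p1) //; last first.
  by apply: etrans (surjective_pairing _) _; congr (_, _); rewrite E av.
rewrite (IH p1) // -idem_arrow -mulrA [val p1]/= [_ * (idem _ * _)]mulrA.
by rewrite arrow_idem -idem_arrow !mulrA idemM eqxx -mulrA exprS.
Qed.

Lemma ex_path v k : exists p : qpath Q, qstart p = v /\ qlen p = k.
Proof.
elim: k v => [|k IH] v; first by exists (@trivial_path Q v).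
have [[[w s] ws] [/= wv sk]] := IH (ordS v).
have pP : @is_walk Q v (v :: s) by rewrite /= eqxx -[ordS v]wv.
by exists (@QPath Q (v, v :: s) pP); split=> //; rewrite -sk.
Qed.

(** Splitting 1 into the idempotents writes the power as the sum over the vertices of the paths of
    length [k]. *)
Lemma arrow_sum_exp k : arrow_ideal_exp k (arrow_sum ^+ k).
Proof.
move=> q qk; rewrite -[_ ^+ _]mul1r -sum_idem mulr_suml.
elim/big_ind: _ => [|x y x0 y0|v _].
- by rewrite -(scale0r (0 : KQ)) pcoefZ mul0r.
- by rewrite pcoefD x0 y0 addr0.
have [p [<- pk]] := ex_path v k; rewrite -pk -path_elt_idem pcoef_elt.
by case: eqP => // pq; rewrite -pk pq ltnn in qk.
Qed.

Definition vert (a : int) : 'I_n.+1 := inord `|(a %% n.+1%:Z)%Z|%N.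

Lemma vertE a : vert a = `|(a %% n.+1%:Z)%Z|%N :> nat.
Proof. by rewrite inordK // -ltz_nat gez0_abs ?modz_ge0 // ltz_pmod. Qed.

Lemma vert_eq a b : (vert a == vert b) = (a == b %[mod n.+1%:Z])%Z.
Proof.
rewrite -val_eqE /= !vertE -eqz_nat !gez0_abs ?modz_ge0 //.
Qed.

Lemma vert_ord (i : 'I_n.+1) : vert i%:Z = i.
Proof. by apply: val_inj; rewrite /= vertE modz_nat absz_nat modn_small. Qed.

Lemma vertS a : vert (a + 1) = ordS (vert a).
Proof.
apply/eqP; rewrite -[X in _ == X]vert_ord vert_eq /= vertE.
rewrite -modz_nat modz_mod; set r := `|_|%N.
have -> : r.+1%:Z = (a %% n.+1%:Z)%Z + 1.
  by rewrite -[r.+1]addn1 PoszD /r gez0_abs ?modz_ge0.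
by rewrite modzDml.
Qed.

End CycleAlgebra.

Theorem proposition4p3p1 (K : fieldType) (L : falgType K)
  (hN : cyclic_nakayama L)
  (hgl : gl_dim L = infty)
  (hDAG : dominant_auslander_gorenstein L) :
  exists d : nat, dom_dim L = fin_enat d /\ ~~ odd d.
Proof.
case: hN => n [I [[_ I2 [m _ Im]] [pi [pis piI]]]].
apply: (@nakayama_dom_dim_even K L n.+1 m
  (fun a => pi (idem K (vert n a))) (pi (arrow_sum K n))) => //.
- by move=> a b ab; have /eqP -> : vert n a == vert n b by rewrite vert_eq ab.
- by move=> a b; rewrite -rmorphM idemM -vert_eq; case: ifP => // _; rewrite rmorph0.
- rewrite -(rmorph1 pi) -sum_idem rmorph_sum; apply: eq_bigr => i _.
  by rewrite vert_ord.
(* Admissibility leaves no coefficient of an element of [I] at a trivial path, whereas [idem] has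
   coefficient 1 there. *)
- move=> a; apply/negP => /eqP /piI /I2 /(_ (trivial_path _)).
  by move=> /(_ (vert n a) isT) /eqP; rewrite pcoef_elt eqxx oner_eq0.
- move=> a; rewrite -!rmorphM idem_arrow; congr (pi _).
  by rewrite vertS arrow_idem.
- by rewrite -rmorphXn; apply/piI/Im/arrow_sum_exp.
move=> P P0 PD PZ Pe y; have [x <-] := pis y.
elim/pa_ind: x => [|x x' Px Px'|c x Px|p].
- by rewrite rmorph0.
- by rewrite rmorphD; apply: PD.
- by rewrite linearZ; apply: PZ.
have := Pe (qstart p : 'I_n.+1)%:Z (qlen p).
by rewrite vert_ord -rmorphXn -rmorphM -path_elt_idem.
Qed.
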